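(* Let $K\subset\mathbb{R}^d$ be compact, let $\omega_n\in K$ be rotation vectors converging to $\omega_\infty\in K$, and let $S_j^n$ ($n\in\mathbb{N}$) and $S_j^\infty$ be families of local potentials satisfying (A)–(E) with a common interaction range $r$, such that $\lim_{n\to\infty}\|\nabla S_0^n-\nabla S_0^\infty\|_{C^1(\mathbb{R}^{\mathbb{Z}^d})}=0$. Let $\Gamma_n$ be a ghost circle for the $S_j^n$ with rotation vector $\omega_n$. Then there exist a ghost circle $\Gamma_\infty$ for the $S_j^\infty$ with rotation vector $\omega_\infty$ and a subsequence $(n_m)$ such that $\Gamma_{n_m}\to\Gamma_\infty$. If moreover $S_j^n\to S_j^\infty$ uniformly on $\mathcal{B}_K$ and every $\Gamma_n$ contains a global minimizer for the $S_j^n$, then $\Gamma_\infty$ contains a global minimizer for the $S_j^\infty$.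
   Context: Notation: $\|i\|=\sum_{k=1}^d|i_k|$, $B_j^r=\{k:\|k-j\|\le r\}$, $(\tau_{k,l}x)_i=x_{i+k}+l$. Local potentials $S_j:\mathbb{R}^{\mathbb{Z}^d}\to\mathbb{R}$, $j\in\mathbb{Z}^d$, satisfy: (A) there is $r\in(0,\infty)$ and $C^2$ functions $s_j:\mathbb{R}^{B_j^r}\to\mathbb{R}$ with $S_j(x)=s_j(x|_{B_j^r})$; (B) $S_j(\tau_{k,l}x)=S_{j+k}(x)$; (C) each $S_j$ is bounded below and $S_j(x)\to\infty$ as $|x_k-x_j|\to\infty$ whenever $\|k-j\|=1$; (D) $\partial_{i,k}S_j\le0$ for $i\ne k$, and $\partial_{i,k}S_i<0$ when $\|i-k\|=1$; (E) $|\partial_{i,k}S_j|\le C$ uniformly. For $S(x)=s(x|_B)$, $B$ finite, $s\in C^{m+1}$: $\|\nabla S\|_{C^m(\mathbb{R}^{\mathbb{Z}^d})}=\sum_{1\le k\le m+1}\sum_{j_1,\dots,j_k}\sup_x|\partial_{j_1\dots j_k}S(x)|$. $\mathbb{X}=\{x:\sum_i2^{-\|i\|}|x_i|<\infty\}$; $(\nabla W(x))_i=\sum_{\|j-i\|\le r}\partial_iS_j(x)$; $\Psi_t$ the complete flow of $\dot x=-\nabla W(x)$ on $\mathbb{X}$. Birkhoff configuration: $\tau_{k,l}x\ge x$ or $\tau_{k,l}x\le x$ (pointwise) for all $(k,l)$; rotation vector $\omega$: $\lim_nx_{ni}/n=\langle\omega,i\rangle$; $\mathcal{B}_K$ is the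 set of Birkhoff configurations with rotation vector in $K$. A ghost circle (for given potentials) is a set $\Gamma\subset\mathbb{R}^{\mathbb{Z}^d}$ that is nonempty, closed and connected (pointwise topology), strictly ordered (for $x,y\in\Gamma$: $x\ll y$, $x=y$ or $y\ll x$), shift-invariant, and satisfies $\Psi_t(\Gamma)=\Gamma$ for all $t\in\mathbb{R}$; its elements are Birkhoff with a common rotation vector, the rotation vector of $\Gamma$, and for each $\xi\in\mathbb{R}$ there is a unique $x(\xi)\in\Gamma$ with $x(\xi)_0=\xi$. Ghost circles $\Gamma_n$ converge to $\Gamma_\infty$ if for every $\xi\in\mathbb{R}$, the configurations $x^n(\xi)\in\Gamma_n$ with $x^n(\xi)_0=\xi$ converge pointwise to the configuration $x^\infty(\xi)\in\Gamma_\infty$ with $x^\infty(\xi)_0=\xi$. Global minimizer: $W_B(x+y)\ge W_B(x)$ for every finite $B$ and every $y$ supported in $\mathring{B}^{(r)}=\{i\in B:B_i^r\subset B\}$, $W_B=\sum_{j\in B}S_j$. *)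

(* Defs.v *)
From Stdlib Require Import Reals Lra ZArith List Classical ClassicalEpsilon.
From Stdlib Require Vector.
Open Scope R_scope.

Definition Zd (d : nat) := Vector.t Z d.
Definition Rd (d : nat) := Vector.t R d.
Definition zero {d} : Zd d := Vector.const 0%Z d.
Definition zadd {d} (i j : Zd d) : Zd d := Vector.map2 Z.add i j.
Definition zsub {d} (i j : Zd d) : Zd d := Vector.map2 Z.sub i j.
Definition zscale {d} (n : Z) (i : Zd d) : Zd d := Vector.map (Z.mul n) i.
Definition lnorm {d} (i : Zd d) : Z :=
  Vector.fold_right (fun a s => (Z.abs a + s)%Z) i 0%Z.
Definition ip {d} (w : Rd d) (i : Zd d) : R :=
  Vector.fold_right Rplus (Vector.map2 (fun a z => a * IZR z) w i) 0.

Definition ball {d} (j : Zd d) (r : R) : Zd d -> Prop :=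
  fun k => IZR (lnorm (zsub k j)) <= r.

Definition Config (d : nat) := Zd d -> R.
Definition Pot (d : nat) := Zd d -> Config d -> R.

Definition lsum {A} (f : A -> R) (L : list A) : R :=
  fold_right (fun a s => f a + s) 0 L.

Definition fsum {A} (P : A -> Prop) (f : A -> R) : R :=
  epsilon (inhabits 0) (fun s => exists L, NoDup L /\ (forall a, In a L <-> P a)
                                         /\ s = lsum f L).

Definition tau {d} (k : Zd d) (l : Z) (x : Config d) : Config d :=
  fun i => x (zadd i k) + IZR l.

Definition upd {d} (x : Config d) (j : Zd d) (t : R) : Config d :=
  fun k => if excluded_middle_informative (k = j) then t else x k.
Definition has_pd {d} (F : Config d -> R) (j : Zd d) (x : Config d) : Prop :=
  exists l, derivable_pt_lim (fun t => F (upd x j t)) (x j) l.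
Definition pd {d} (F : Config d -> R) (j : Zd d) (x : Config d) : R :=
  epsilon (inhabits 0) (fun l => derivable_pt_lim (fun t => F (upd x j t)) (x j) l).
Definition pd2 {d} (F : Config d -> R) (i k : Zd d) (x : Config d) : R :=
  pd (pd F k) i x.

Definition depends_only {d} (F : Config d -> R) (B : Zd d -> Prop) : Prop :=
  forall x y, (forall k, B k -> x k = y k) -> F x = F y.
Definition cont_on {d} (F : Config d -> R) (B : Zd d -> Prop) : Prop :=
  forall x eps, 0 < eps -> exists delta, 0 < delta /\
    forall y, (forall k, B k -> Rabs (y k - x k) < delta) -> Rabs (F y - F x) < eps.
(** F(x) = s(x|_B) with s : R^B -> R of class C^2 *)
Definition C2_local {d} (F : Config d -> R) (B : Zd d -> Prop) : Prop :=
  depends_only F B /\ cont_on F B /\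
  (forall j x, has_pd F j x) /\ (forall j, cont_on (pd F j) B) /\
  (forall i j x, has_pd (pd F j) i x) /\ (forall i j, cont_on (pd2 F i j) B).

Definition cond_A {d} (S : Pot d) (r : R) : Prop :=
  0 < r /\ forall j, C2_local (S j) (ball j r).
Definition cond_B {d} (S : Pot d) : Prop :=
  forall j k l x, S j (tau k l x) = S (zadd j k) x.
Definition cond_C {d} (S : Pot d) : Prop :=
  forall j, (exists m, forall x, m <= S j x) /\
    forall k, lnorm (zsub k j) = 1%Z ->
      forall M, exists R0, forall x, R0 <= Rabs (x k - x j) -> M <= S j x.
Definition cond_D {d} (S : Pot d) : Prop :=
  (forall i k j x, i <> k -> pd2 (S j) i k x <= 0) /\
  (forall i k x, lnorm (zsub i k) = 1%Z -> pd2 (S i) i k x < 0).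
Definition cond_E {d} (S : Pot d) : Prop :=
  exists C, forall i k j x, Rabs (pd2 (S j) i k x) <= C.
Definition local_potentials {d} (S : Pot d) (r : R) : Prop :=
  cond_A S r /\ cond_B S /\ cond_C S /\ cond_D S /\ cond_E S.

(** ||nabla F||_{C^1} <= eps, i.e. sum_j sup_x |d_j F| + sum_{j1,j2} sup_x |d_{j1 j2} F| <= eps *)
Definition C1norm_grad_le {d} (F : Config d -> R) (eps : R) : Prop :=
  forall (L1 : list (Zd d * Config d)) (L2 : list ((Zd d * Zd d) * Config d)),
    NoDup (map fst L1) -> NoDup (map fst L2) ->
    lsum (fun p => Rabs (pd F (fst p) (snd p))) L1
    + lsum (fun p => Rabs (pd2 F (fst (fst p)) (snd (fst p)) (snd p))) L2 <= eps.

Definition wsum {d} (L : list (Zd d)) (x : Config d) : R :=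
  lsum (fun i => (/2) ^ Z.to_nat (lnorm i) * Rabs (x i)) L.
Definition inX {d} (x : Config d) : Prop :=
  exists M, forall L, NoDup L -> wsum L x <= M.

Definition gradW {d} (S : Pot d) (r : R) (x : Config d) : Config d :=
  fun i => fsum (ball i r) (fun j => pd (S j) i x).

(** solution curves of  xdot = - nabla W(x)  in the Banach space X
    (derivative w.r.t. the norm  ||x||_X = sum_i 2^{-||i||}|x_i|) *)
Definition flow_line {d} (S : Pot d) (r : R) (g : R -> Config d) : Prop :=
  (forall t, inX (g t)) /\
  forall t eps, 0 < eps -> exists delta, 0 < delta /\
    forall h, h <> 0 -> Rabs h < delta ->
      forall L, NoDup L ->
        wsum L (fun i => g (t + h) i - g t i + h * gradW S r (g t) i) <= eps * Rabs h.

Definition pw_open {d} (U : Config d -> Prop) : Prop :=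
  forall x, U x -> exists (L : list (Zd d)) eps, 0 < eps /\
    forall y, (forall i, In i L -> Rabs (y i - x i) < eps) -> U y.
Definition pw_closed {d} (G : Config d -> Prop) : Prop :=
  pw_open (fun x => ~ G x).
Definition pw_connected {d} (G : Config d -> Prop) : Prop :=
  ~ exists U V, pw_open U /\ pw_open V /\
      (forall x, G x -> U x \/ V x) /\ (exists x, G x /\ U x) /\
      (exists x, G x /\ V x) /\ (forall x, G x -> U x -> V x -> False).

Definition sll {d} (x y : Config d) : Prop := forall i, x i < y i.

Definition ghost_circle {d} (S : Pot d) (r : R) (G : Config d -> Prop) : Prop :=
  (exists x, G x) /\ pw_closed G /\ pw_connected G /\
  (forall x y, G x -> G y -> sll x y \/ x = y \/ sll y x) /\
  (forall k l x, G x -> G (tau k l x)) /\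
  (forall k l y, G y -> exists x, G x /\ y = tau k l x) /\
  (* Psi_t(Gamma) = Gamma for all t *)
  (forall x, G x -> inX x) /\
  (forall x, G x -> forall g, flow_line S r g -> g 0 = x -> forall t, G (g t)).

Definition Birkhoff {d} (x : Config d) : Prop :=
  forall k l, (forall i, x i <= tau k l x i) \/ (forall i, tau k l x i <= x i).
Definition has_rot {d} (x : Config d) (w : Rd d) : Prop :=
  forall i, Un_cv (fun n => x (zscale (Z.of_nat n) i) / INR n) (ip w i).
Definition ghost_rot {d} (G : Config d -> Prop) (w : Rd d) : Prop :=
  forall x, G x -> has_rot x w.
Definition in_BK {d} (K : Rd d -> Prop) (x : Config d) : Prop :=
  Birkhoff x /\ exists w, K w /\ has_rot x w.

Definition ghost_conv {d} (Gs : nat -> Config d -> Prop) (G : Config d -> Prop) : Prop :=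
  forall xi (xs : nat -> Config d) (x : Config d),
    (forall n, Gs n (xs n) /\ xs n zero = xi) -> G x -> x zero = xi ->
    forall i, Un_cv (fun n => xs n i) (x i).

Definition global_min {d} (S : Pot d) (r : R) (x : Config d) : Prop :=
  forall (B : list (Zd d)) (y : Config d), NoDup B ->
    (forall i, y i <> 0 -> In i B /\ forall k, ball i r k -> In k B) ->
    lsum (fun j => S j x) B <= lsum (fun j => S j (fun i => x i + y i)) B.

Definition Rd_open {d} (U : Rd d -> Prop) : Prop :=
  forall w, U w -> exists eps, 0 < eps /\
    forall v, (forall k, Rabs (Vector.nth v k - Vector.nth w k) < eps) -> U v.
Definition Rd_compact {d} (K : Rd d -> Prop) : Prop :=
  forall (I : Type) (U : I -> Rd d -> Prop), (forall a, Rd_open (U a)) ->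
    (forall w, K w -> exists a, U a w) ->
    exists L : list I, forall w, K w -> exists a, In a L /\ U a w.

Definition Rd_cv {d} (ws : nat -> Rd d) (w : Rd d) : Prop :=
  forall k, Un_cv (fun n => Vector.nth (ws n) k) (Vector.nth w k).

(* Main.v *)
Require Import Defs.
From Stdlib Require Import Reals Lra Lia ZArith List Permutation.
From Stdlib Require Import Classical ClassicalEpsilon FunctionalExtensionality.
From Stdlib Require Vector Cantor.
From Coquelicot Require Coquelicot.
Open Scope R_scope.

(** Choose a subsequence along which, for every rational [q] and every site, the elements of the
    ghost circles with zeroth coordinate [q] converge, and let the limit circle be the set of all
    pointwise limits of elements of the circles in that subsequence.  Everything rests on the fact
    that two such limits [x], [y] are equal as soon as they agree at one site.  The flow lines
    through their approximants are ordered for all times, because distinct elements of an invariant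
    ghost circle never meet under the flow, and they converge to flow lines of the limit potentials
    by Gronwall's inequality for the norm [sup_i 2^-|i| |u_i|].  So the limit flow lines stay weakly
    ordered for all times, including negative ones.  If the difference [u >= 0] vanishes at [(0, i)],
    then [u_i' >= - A u_i] forces [u_i = 0] on all of the past, hence [u_i' = 0] there, and the twist
    condition (D) makes [u] vanish at the neighbours of [i], and eventually everywhere.

    Compactness and this rigidity give existence and continuity in the zeroth coordinate, hence
    connectedness and convergence.  Minimality compares S(x+y) with S(x), and such differences
    converge with the gradients, so the [C^1] hypothesis alone passes it to the limit. *)

(** * Lattice and finite sums *)

(** Flow invariance of a ghost circle speaks of flow lines that are already given, so it yields
    nothing until flow lines are shown to exist; they are therefore constructed by hand. The field
    [gradW] need not be bounded, but it is Lipschitz with finite range and bounded at each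
    configuration of linear growth, so Picard iteration works for displacements bounded uniformly
    over the sites.

    A second obstacle is that pointwise convergence is too weak for Gronwall. Comparing an element
    with its integer translates gives [|x_i - x_0 - <w, i>| <= 1], with a constant independent of
    the circle. With the boundedness of the rotation vectors this yields a common linear growth,
    precompactness, the rotation vector of the limit and, since [2^-|i|] beats linear growth,
    convergence in the weighted supremum norm.

    A third is that limits along further subsequences do not lie in the limit set by definition.
    Rigidity repairs this: such a limit coincides with the element of the limit set having the same
    zeroth coordinate, and density of the rational values together with compactness supplies that
    element. *)

Lemma zd_ext {d} (i j : Zd d) : (forall p, Vector.nth i p = Vector.nth j p) -> i = j.
Proof. intros H; apply Vector.eq_nth_iff; intros p q <-; apply H. Qed.

Lemma nth_zadd {d} (i j : Zd d) p : Vector.nth (zadd i j) p = (Vector.nth i p + Vector.nth j p)%Z.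
Proof. now apply Vector.nth_map2. Qed.
Lemma nth_zsub {d} (i j : Zd d) p : Vector.nth (zsub i j) p = (Vector.nth i p - Vector.nth j p)%Z.
Proof. now apply Vector.nth_map2. Qed.
Lemma nth_zero {d} p : Vector.nth (@zero d) p = 0%Z.
Proof. apply Vector.const_nth. Qed.
Lemma nth_zscale {d} n (i : Zd d) p : Vector.nth (zscale n i) p = (n * Vector.nth i p)%Z.
Proof. now apply Vector.nth_map. Qed.

Ltac zd := apply zd_ext; intros ?p; rewrite ?nth_zadd, ?nth_zsub, ?nth_zscale, ?nth_zero,
  ?nth_zadd, ?nth_zsub, ?nth_zero; lia.

Lemma zadd_zero_l {d} (i : Zd d) : zadd zero i = i. Proof. zd. Qed.
Lemma zadd_zero_r {d} (i : Zd d) : zadd i zero = i. Proof. zd. Qed.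
Lemma zadd_comm {d} (i j : Zd d) : zadd i j = zadd j i. Proof. zd. Qed.
Lemma zadd_zsub {d} (i j : Zd d) : zadd (zsub i j) j = i. Proof. zd. Qed.
Lemma zadd_zsub_l {d} (i j : Zd d) : zadd j (zsub i j) = i. Proof. zd. Qed.
Lemma zsub_zadd {d} (i j : Zd d) : zsub (zadd i j) j = i. Proof. zd. Qed.
Lemma zsub_zadd_l {d} (i j : Zd d) : zsub (zadd j i) j = i. Proof. zd. Qed.
Lemma zsub_zero_r {d} (i : Zd d) : zsub i zero = i. Proof. zd. Qed.
Lemma zsub_diag {d} (i : Zd d) : zsub i i = zero. Proof. zd. Qed.

Lemma zadd_inj {d} (i j k : Zd d) : zadd i j = zadd i k -> j = k.
Proof. intros H; rewrite <- (zsub_zadd_l j i), H; apply zsub_zadd_l. Qed.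

Lemma lnorm_cons {d} a (v : Zd d) : lnorm (Vector.cons Z a d v) = (Z.abs a + lnorm v)%Z.
Proof. reflexivity. Qed.

Lemma lnorm_nonneg {d} (i : Zd d) : (0 <= lnorm i)%Z.
Proof. induction i; [cbn; lia | rewrite lnorm_cons; lia]. Qed.

Lemma lnorm_zero {d} : lnorm (@zero d) = 0%Z.
Proof.
  induction d; [reflexivity|]. change (@zero (S d)) with (Vector.cons Z 0%Z d zero).
  rewrite lnorm_cons, IHd; reflexivity.
Qed.

Lemma lnorm_zadd {d} (i j : Zd d) : (lnorm (zadd i j) <= lnorm i + lnorm j)%Z.
Proof.
  refine (Vector.rect2 (fun d i j => (@lnorm d (zadd i j) <= lnorm i + lnorm j)%Z) _ _ i j); [cbn; lia|].
  clear; intros n v w IH a b. change (zadd (Vector.cons _ a _ v) (Vector.cons _ b _ w)) with (Vector.cons _ (a+b)%Z _ (zadd v w)).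
  rewrite !lnorm_cons; lia.
Qed.

Lemma lnorm_zsub_sym {d} (i j : Zd d) : lnorm (zsub i j) = lnorm (zsub j i).
Proof.
  refine (Vector.rect2 (fun d i j => @lnorm d (zsub i j) = lnorm (zsub j i)) _ _ i j); [reflexivity|].
  clear; intros n v w IH a b. change (zsub (Vector.cons _ a _ v) (Vector.cons _ b _ w)) with (Vector.cons _ (a-b)%Z _ (zsub v w)).
  change (zsub (Vector.cons _ b _ w) (Vector.cons _ a _ v)) with (Vector.cons _ (b-a)%Z _ (zsub w v)).
  rewrite !lnorm_cons; lia.
Qed.

Lemma lnorm_zsub_triangle {d} (i j k : Zd d) : (lnorm (zsub i k) <= lnorm (zsub i j) + lnorm (zsub j k))%Z.
Proof.
  replace (zsub i k) with (zadd (zsub i j) (zsub j k)) by zd. apply lnorm_zadd.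
Qed.

Lemma lnorm_le_zsub {d} (i j : Zd d) : (lnorm i <= lnorm j + lnorm (zsub i j))%Z.
Proof. rewrite <- (zadd_zsub_l i j) at 1. apply lnorm_zadd. Qed.

Lemma unit_step {d} (v : Zd d) : v <> zero ->
  exists e, lnorm e = 1%Z /\ (lnorm (zsub v e) < lnorm v)%Z.
Proof.
  induction v as [|a d v IH]; intros H; [now contradiction H|].
  destruct (Z.eq_dec a 0) as [->|Ha].
  - destruct IH as [e [He Hl]].
    { intros ->. now apply H. }
    exists (Vector.cons _ 0%Z _ e).
    change (zsub (Vector.cons _ 0%Z _ v) (Vector.cons _ 0%Z _ e)) with (Vector.cons _ 0%Z _ (zsub v e)).
    rewrite !lnorm_cons; lia.
  - exists (Vector.cons _ (Z.sgn a) _ zero).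
    change (zsub (Vector.cons _ a _ v) (Vector.cons _ (Z.sgn a) _ zero))
      with (Vector.cons _ (a - Z.sgn a)%Z _ (zsub v zero)).
    rewrite !lnorm_cons, lnorm_zero, zsub_zero_r; lia.
Qed.

(** Induction on the distance to [i]: [unit_step] supplies a neighbour of [k] that is closer to [i].
    This later turns the spread of a contact to neighbours into its spread to all sites. *)
Lemma lattice_connected {d} (P : Zd d -> Prop) (i : Zd d) :
  P i -> (forall j k, lnorm (zsub k j) = 1%Z -> P j -> P k) -> forall k, P k.
Proof.
  intros Hi Hstep.
  assert (H : forall n k, (lnorm (zsub k i) < Z.of_nat n)%Z -> P k).
  { induction n; intros k Hk; [pose proof (lnorm_nonneg (zsub k i)); lia|].
    destruct (classic (zsub k i = zero)) as [E|E].
    - replace k with i; [assumption|]. rewrite <- (zadd_zsub k i), E. symmetry; apply zadd_zero_l.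
    - destruct (unit_step _ E) as [e [He Hl]].
      apply (Hstep (zsub k e)).
      + now replace (zsub k (zsub k e)) with e by zd.
      + apply IHn. replace (zsub (zsub k e) i) with (zsub (zsub k i) e) by zd. lia. }
  intros k; apply (H (S (Z.to_nat (lnorm (zsub k i))))).
  pose proof (lnorm_nonneg (zsub k i)); lia.
Qed.

Lemma lsum_cons {A} (f : A -> R) a L : lsum f (a :: L) = f a + lsum f L.
Proof. reflexivity. Qed.

Lemma lsum_ext {A} (f g : A -> R) L : (forall a, In a L -> f a = g a) -> lsum f L = lsum g L.
Proof.
  induction L as [|a L IH]; intros H; [reflexivity|]. rewrite !lsum_cons.
  rewrite (H a), IH; [reflexivity| |now left]. intros b Hb; apply H; now right.
Qed.

Lemma lsum_le {A} (f g : A -> R) L : (forall a, In a L -> f a <= g a) -> lsum f L <= lsum g L.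
Proof.
  induction L as [|a L IH]; intros H; [cbn; lra|]. rewrite !lsum_cons.
  apply Rplus_le_compat; [apply H; now left|]. apply IH; intros b Hb; apply H; now right.
Qed.

Lemma lsum_nonneg {A} (f : A -> R) L : (forall a, In a L -> 0 <= f a) -> 0 <= lsum f L.
Proof.
  induction L as [|a L IH]; intros H; [cbn; lra|]. rewrite !lsum_cons.
  apply Rplus_le_le_0_compat; [apply H; now left|]. apply IH; intros b Hb; apply H; now right.
Qed.

Lemma lsum_app {A} (f : A -> R) L L' : lsum f (L ++ L') = lsum f L + lsum f L'.
Proof.
  induction L as [|a L IH]; cbn [app]; [change (lsum f nil) with 0; lra|].
  rewrite !lsum_cons, IH; lra.
Qed.

Lemma lsum_map {A B} (f : B -> R) (g : A -> B) L : lsum f (map g L) = lsum (fun a => f (g a)) L.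
Proof. induction L as [|a L IH]; [reflexivity|]; cbn [map app]; rewrite ?lsum_cons. now rewrite IH. Qed.

Lemma lsum_scal {A} (f : A -> R) c L : lsum (fun a => c * f a) L = c * lsum f L.
Proof. induction L as [|a L IH]; [cbn; lra|]; rewrite ?lsum_cons. rewrite IH; lra. Qed.

Lemma lsum_plus {A} (f g : A -> R) L : lsum (fun a => f a + g a) L = lsum f L + lsum g L.
Proof. induction L as [|a L IH]; [cbn; lra|]; rewrite ?lsum_cons. rewrite IH; lra. Qed.

Lemma lsum_minus {A} (f g : A -> R) L : lsum (fun a => f a - g a) L = lsum f L - lsum g L.
Proof. induction L as [|a L IH]; [cbn; lra|]; rewrite ?lsum_cons. rewrite IH; lra. Qed.

Lemma lsum_const {A} c (L : list A) : lsum (fun _ => c) L = INR (length L) * c.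
Proof.
  induction L as [|a L IH]; [cbn; lra|].
  change (lsum (fun _ => c) (a :: L)) with (c + lsum (fun _ => c) L).
  cbn [length]; rewrite S_INR, IH; lra.
Qed.

Lemma lsum_abs {A} (f : A -> R) L : Rabs (lsum f L) <= lsum (fun a => Rabs (f a)) L.
Proof.
  induction L; [cbn; rewrite Rabs_R0; lra|].
  rewrite !lsum_cons.
  eapply Rle_trans; [apply Rabs_triang|]. apply Rplus_le_compat_l, IHL.
Qed.

Lemma lsum_perm {A} (f : A -> R) L L' : Permutation L L' -> lsum f L = lsum f L'.
Proof. induction 1; rewrite ?lsum_cons; [reflexivity|lra|lra|lra]. Qed.

Lemma lsum_incl {A} (f : A -> R) L L' : (forall a, 0 <= f a) -> NoDup L -> incl L L' -> lsum f L <= lsum f L'.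
Proof.
  intros Hf H; revert L'; induction H as [|a L Ha HL IH]; intros L' HI.
  - apply lsum_nonneg; auto.
  - destruct (in_split a L') as [l1 [l2 ->]]; [apply HI; now left|].
    rewrite (lsum_perm f (l1 ++ a :: l2) (a :: l1 ++ l2)) by (symmetry; apply Permutation_middle).
    rewrite !lsum_cons. apply Rplus_le_compat_l, IH. intros b Hb.
    assert (In b (l1 ++ a :: l2)) as Hb' by (apply HI; now right).
    apply in_app_or in Hb'; apply in_or_app; destruct Hb' as [|[->|]]; auto. contradiction.
Qed.

Lemma lsum_single {A} (f : A -> R) L a : (forall b, 0 <= f b) -> In a L -> f a <= lsum f L.
Proof.
  intros Hf Ha. replace (f a) with (lsum f (a :: nil)) by (cbn; lra).
  apply lsum_incl; auto; [repeat constructor; auto|]. intros b [<-|[]]; assumption.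
Qed.

(** * Enumeration of lattice boxes and summable geometric weights *)

Fixpoint zrange (N : nat) : list Z :=
  match N with
  | O => 0%Z :: nil
  | S N => Z.of_nat (S N) :: (- Z.of_nat (S N))%Z :: zrange N
  end.

Lemma in_zrange N a : (Z.abs a <= Z.of_nat N)%Z -> In a (zrange N).
Proof.
  induction N; intros H; [left; lia|].
  destruct (Z.eq_dec a (Z.of_nat (S N))) as [->|]; [now left|].
  destruct (Z.eq_dec a (- Z.of_nat (S N))) as [->|]; [right; now left|].
  right; right; apply IHN; lia.
Qed.

(** Partial sums of the series of [q^|a|] over all integers [a], whose value [(1 + q) / (1 - q)] is
    7 for [q = 3/4]. This is the origin of every constant [7 ^ d] below. *)
Lemma zrange_geom N : lsum (fun a => (3/4) ^ Z.to_nat (Z.abs a)) (zrange N) = 7 - 6 * (3/4)^N.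
Proof.
  induction N; [cbn; lra|]. cbn [zrange]. rewrite !lsum_cons, IHN.
  replace (Z.to_nat (Z.abs (Z.of_nat (S N)))) with (S N) by lia.
  replace (Z.to_nat (Z.abs (- Z.of_nat (S N)))) with (S N) by lia.
  cbn [pow]; lra.
Qed.

Fixpoint box (d N : nat) : list (Zd d) :=
  match d with
  | O => Vector.nil Z :: nil
  | S d => flat_map (fun a => map (fun v => Vector.cons Z a d v) (box d N)) (zrange N)
  end.

Lemma in_box {d} N (i : Zd d) : (lnorm i <= Z.of_nat N)%Z -> In i (box d N).
Proof.
  induction i as [|a d v IH]; intros H; [now left|]. rewrite lnorm_cons in H.
  pose proof (lnorm_nonneg v).
  cbn [box]. apply in_flat_map. exists a. split; [apply in_zrange; lia|].
  apply in_map, IH; lia.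
Qed.

Lemma list_in_box {d} (L : list (Zd d)) : exists N, incl L (box d N).
Proof.
  assert (exists N : nat, forall i, In i L -> (lnorm i <= Z.of_nat N)%Z) as [N HN].
  { induction L as [|a L [N HN]]; [exists O; intros ? []|].
    exists (Nat.max N (Z.to_nat (lnorm a))). intros i [<-|Hi]; [pose proof (lnorm_nonneg a); lia|].
    specialize (HN i Hi); lia. }
  exists N; intros i Hi; apply in_box; auto.
Qed.

(** Used with two ratios: [1/2] is the weight in the norm of the space X, and [3/4] is a summable
    weight that, up to a constant, dominates the former even after multiplication by a linearly
    growing factor. *)
Definition geo {d} (q : R) (i : Zd d) : R := q ^ Z.to_nat (lnorm i).

Lemma geo_pos {d} q (i : Zd d) : 0 < q -> 0 < geo q i.
Proof. intros; now apply pow_lt. Qed.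

Lemma geo_cons {d} q a (v : Zd d) : geo q (Vector.cons _ a _ v) = q ^ Z.to_nat (Z.abs a) * geo q v.
Proof.
  unfold geo; rewrite lnorm_cons, <- pow_add; f_equal. pose proof (lnorm_nonneg v). lia.
Qed.

Lemma box_geo d N : lsum (geo (3/4)) (box d N) <= 7 ^ d.
Proof.
  induction d; [cbn; lra|]. cbn [box].
  (* The weight is a product over coordinates, so its sum over the box factorises. *)
  assert (H : lsum (geo (3/4)) (flat_map (fun a => map (fun v => Vector.cons Z a d v) (box d N)) (zrange N))
     = lsum (fun a => (3/4) ^ Z.to_nat (Z.abs a)) (zrange N) * lsum (geo (3/4)) (box d N)).
  { generalize (zrange N) as L. induction L as [|a L IH]; [cbn; lra|].
    cbn [flat_map]. rewrite lsum_app, IH, lsum_map.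
    rewrite (lsum_ext _ (fun v => (3/4) ^ Z.to_nat (Z.abs a) * geo (3/4) v))
      by (intros; apply geo_cons).
    rewrite lsum_scal, lsum_cons. lra. }
  rewrite H, zrange_geom. cbn [pow].
  assert (0 <= lsum (geo (3/4)) (box d N)) by (apply lsum_nonneg; intros; left; apply geo_pos; lra).
  assert (0 < (3/4)^N) by (apply pow_lt; lra).
  apply Rmult_le_compat; auto; [|lra].
  assert ((3/4)^N <= 1) by (rewrite <- (pow1 N); apply pow_incr; lra). lra.
Qed.

Lemma geo_summable {d} (L : list (Zd d)) : NoDup L -> lsum (geo (3/4)) L <= 7 ^ d.
Proof.
  intros HL. destruct (list_in_box L) as [N HN].
  eapply Rle_trans; [|apply (box_geo d N)]. apply lsum_incl; auto.
  intros; left; apply geo_pos; lra.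
Qed.

(** * Enumeration of balls *)

Definition radius (r : R) : nat := Z.to_nat (up r).

Lemma ball_radius {d} (j k : Zd d) r : ball j r k -> (lnorm (zsub k j) <= Z.of_nat (radius r))%Z.
Proof.
  unfold ball, radius; intros H. pose proof (archimed r) as [Hu _].
  assert (IZR (lnorm (zsub k j)) < IZR (up r)) as Hl by lra. apply lt_IZR in Hl.
  pose proof (lnorm_nonneg (zsub k j)). lia.
Qed.

Definition prop_dec {A} (P : A -> Prop) (a : A) : bool :=
  if excluded_middle_informative (P a) then true else false.

(** Every ball is listed as a translate of one list around the origin, so all these lists have the
    same length and the estimates below have constants independent of the site. *)
Definition ball_list {d} (r : R) (j : Zd d) : list (Zd d) :=
  map (zadd j) (nodup (fun x y => excluded_middle_informative (x = y))
    (filter (prop_dec (ball zero r)) (box d (radius r)))).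

Lemma in_ball_list {d} r (j k : Zd d) : In k (ball_list r j) <-> ball j r k.
Proof.
  unfold ball_list. rewrite in_map_iff. split.
  - intros [v [<- Hv]]. apply nodup_In, filter_In in Hv as [_ Hv].
    unfold prop_dec in Hv. destruct excluded_middle_informative as [Hb|]; [|discriminate].
    unfold ball in *. now rewrite zsub_zadd_l; rewrite zsub_zero_r in Hb.
  - intros H. exists (zsub k j). split; [apply zadd_zsub_l|].
    assert (ball zero r (zsub k j)) as Hb by (unfold ball in *; now rewrite zsub_zero_r).
    apply nodup_In, filter_In; split.
    + apply in_box. apply ball_radius in Hb. now rewrite zsub_zero_r in Hb.
    + unfold prop_dec. now destruct excluded_middle_informative.
Qed.

Lemma ball_list_NoDup {d} r (j : Zd d) : NoDup (ball_list r j).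
Proof.
  unfold ball_list. apply FinFun.Injective_map_NoDup; [|apply NoDup_nodup].
  intros a b; apply zadd_inj.
Qed.

Lemma ball_list_length {d} r (j : Zd d) : length (ball_list r j) = length (ball_list r (@zero d)).
Proof. unfold ball_list; now rewrite !length_map. Qed.

(** [fsum] picks the sum over some enumeration by choice; two duplicate-free enumerations of the
    same ball are permutations of each other, so the pick is immaterial. *)
Lemma fsum_ball {d} r (j : Zd d) f : fsum (ball j r) f = lsum f (ball_list r j).
Proof.
  unfold fsum. destruct (epsilon_spec (inhabits 0)
    (fun s => exists L, NoDup L /\ (forall a, In a L <-> ball j r a) /\ s = lsum f L)) as [L [HL [HI ->]]].
  - exists (lsum f (ball_list r j)), (ball_list r j).
    split; [apply ball_list_NoDup|]. split; [apply in_ball_list|reflexivity].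
  - apply lsum_perm, NoDup_Permutation; auto using ball_list_NoDup.
    intros k; now rewrite HI, in_ball_list.
Qed.

Lemma ball_sym {d} (i j : Zd d) r : ball i r j -> ball j r i.
Proof. unfold ball; now rewrite lnorm_zsub_sym. Qed.

(** * Partial derivatives and local potentials *)

(** The endpoints come in any order, and may coincide, because flow lines are followed forwards and
    backwards in time. *)
Lemma mean_value (f f' : R -> R) a b : (forall c, derivable_pt_lim f c (f' c)) ->
  exists c, Rmin a b <= c <= Rmax a b /\ f b - f a = f' c * (b - a).
Proof.
  intros H. destruct (Rtotal_order a b) as [Hab|[<-|Hab]].
  - destruct (MVT_cor2 f f' a b Hab) as [c [Hc [H1 H2]]]; [auto|].
    exists c; rewrite Rmin_left, Rmax_right by lra; split; [lra|assumption].
  - exists a; rewrite Rmin_left, Rmax_left by lra; split; [lra|ring].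
  - destruct (MVT_cor2 f f' b a Hab) as [c [Hc [H1 H2]]]; [auto|].
    exists c; rewrite Rmin_right, Rmax_left by lra; split; [lra|].
    apply Ropp_eq_compat in Hc. lra.
Qed.

Lemma upd_same {d} (x : Config d) j t : upd x j t j = t.
Proof. unfold upd; now destruct excluded_middle_informative. Qed.

Lemma upd_other {d} (x : Config d) j t k : k <> j -> upd x j t k = x k.
Proof. intros H; unfold upd; now destruct excluded_middle_informative. Qed.

Lemma upd_self {d} (x : Config d) j : upd x j (x j) = x.
Proof.
  apply functional_extensionality; intros k; unfold upd.
  destruct excluded_middle_informative as [->|]; reflexivity.
Qed.

Lemma upd_upd {d} (x : Config d) j s t : upd (upd x j s) j t = upd x j t.
Proof.
  apply functional_extensionality; intros k; unfold upd.
  destruct excluded_middle_informative; reflexivity.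
Qed.

Lemma pd_eq {d} (F : Config d -> R) j x l :
  derivable_pt_lim (fun t => F (upd x j t)) (x j) l -> pd F j x = l.
Proof.
  intros H. apply (uniqueness_limite (fun t => F (upd x j t)) (x j)); [|exact H].
  unfold pd. apply epsilon_spec. now exists l.
Qed.

Lemma pd_spec {d} (F : Config d -> R) j x : has_pd F j x ->
  derivable_pt_lim (fun t => F (upd x j t)) (x j) (pd F j x).
Proof. intros [l H]. now rewrite (pd_eq F j x l H). Qed.

Lemma pd_line {d} (F : Config d -> R) j x t : (forall z, has_pd F j z) ->
  derivable_pt_lim (fun t => F (upd x j t)) t (pd F j (upd x j t)).
Proof.
  intros H. pose proof (pd_spec F j (upd x j t) (H _)) as P. rewrite upd_same in P.
  replace (fun t => F (upd x j t)) with (fun t0 => F (upd (upd x j t) j t0)); [exact P|].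
  apply functional_extensionality; intros s; now rewrite upd_upd.
Qed.

Lemma pd_mean_value {d} (F : Config d -> R) j x t : (forall z, has_pd F j z) ->
  exists z, F (upd x j t) - F x = pd F j z * (t - x j).
Proof.
  intros H.
  destruct (mean_value (fun t => F (upd x j t)) (fun t => pd F j (upd x j t)) (x j) t) as [c [_ Hc]].
  - intros c; now apply pd_line.
  - exists (upd x j c). now rewrite <- Hc, upd_self.
Qed.

Lemma pd_minus {d} (F G : Config d -> R) j x : has_pd F j x -> has_pd G j x ->
  pd (fun y => F y - G y) j x = pd F j x - pd G j x.
Proof.
  intros HF HG. apply pd_eq. apply (derivable_pt_lim_minus (fun t => F (upd x j t)) (fun t => G (upd x j t)));
    now apply pd_spec.
Qed.

Lemma pd_not_in {d} (F : Config d -> R) B j x : depends_only F B -> ~ B j -> pd F j x = 0.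
Proof.
  intros HF Hj. apply pd_eq.
  replace (fun t => F (upd x j t)) with (fct_cte (F x)); [apply derivable_pt_lim_const|].
  apply functional_extensionality; intros t; apply HF. intros k Hk.
  rewrite upd_other; [reflexivity|]. intros ->; contradiction.
Qed.

Lemma pd_depends_only {d} (F : Config d -> R) B j : depends_only F B -> (forall z, has_pd F j z) ->
  depends_only (pd F j) B.
Proof.
  intros HF Hd x y Hxy. destruct (classic (B j)) as [Hj|Hj].
  - apply pd_eq. rewrite (Hxy j Hj).
    replace (fun t => F (upd x j t)) with (fun t => F (upd y j t)); [now apply pd_spec|].
    apply functional_extensionality; intros t; apply HF. intros k Hk. unfold upd.
    destruct excluded_middle_informative; [reflexivity|]. symmetry; auto.
  - now rewrite !(pd_not_in F B).
Qed.

(* The telescoping behind both comparison lemmas: move from [x] to [y] one coordinate at a time. *)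
Lemma coordinate_path_ind {d} (P : Config d -> Config d -> list (Zd d) -> Prop) :
  (forall x, P x x nil) ->
  (forall x y a L, P (upd x a (y a)) y L -> P x y (a :: L)) ->
  forall L x y, (forall k, ~ In k L -> x k = y k) -> P x y L.
Proof.
  intros H0 HS L; induction L as [|a L IH]; intros x y Hxy.
  - replace y with x; [apply H0|]. apply functional_extensionality; intros k; apply Hxy; intros [].
  - apply HS, IH. intros k Hk. destruct (classic (k = a)) as [->|Hka]; [apply upd_same|].
    rewrite upd_other by assumption. apply Hxy. intros [->|]; contradiction.
Qed.

(** Two configurations may differ at infinitely many sites, where a path changing one coordinate at
    a time never ends. For a function of finitely many coordinates, this hybrid has the value at [x]
    and differs from [y] only on [L]. *)
Definition splice {d} (L : list (Zd d)) (x y : Config d) : Config d :=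
  fun k => if excluded_middle_informative (In k L) then x k else y k.

Lemma splice_eq {d} (F : Config d -> R) B L x y : depends_only F B -> (forall k, B k -> In k L) ->
  F (splice L x y) = F x.
Proof.
  intros HF HB; apply HF; intros k Hk; unfold splice.
  destruct excluded_middle_informative; [reflexivity|]. exfalso; auto.
Qed.

Lemma splice_out {d} L (x y : Config d) k : ~ In k L -> splice L x y k = y k.
Proof. intros H; unfold splice; now destruct excluded_middle_informative. Qed.

Lemma pd_bounded_lipschitz {d} (F : Config d -> R) B L C :
  depends_only F B -> (forall k, B k -> In k L) -> (forall j z, has_pd F j z) ->
  (forall j z, Rabs (pd F j z) <= C) ->
  forall x y, Rabs (F y - F x) <= C * lsum (fun k => Rabs (y k - x k)) L.
Proof.
  intros HF HB Hd HC.
  assert (HC0 : 0 <= C) by (eapply Rle_trans; [apply Rabs_pos|apply (HC zero (fun _ => 0))]).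
  assert (G : forall x y, (forall k, ~ In k L -> x k = y k) ->
     Rabs (F y - F x) <= C * lsum (fun k => Rabs (y k - x k)) L).
  { apply (coordinate_path_ind (fun x y L => Rabs (F y - F x) <= C * lsum (fun k => Rabs (y k - x k)) L)).
    - intros x; rewrite Rminus_diag, Rabs_R0; cbn; lra.
    - clear L HB. intros x y a L IH. rewrite lsum_cons.
      destruct (pd_mean_value F a x (y a) (Hd a)) as [z Hz].
      replace (F y - F x) with ((F y - F (upd x a (y a))) + pd F a z * (y a - x a)) by lra.
      eapply Rle_trans; [apply Rabs_triang|]. rewrite Rmult_plus_distr_l, Rplus_comm, Rabs_mult.
      apply Rplus_le_compat; [apply Rmult_le_compat_r; [apply Rabs_pos|apply HC]|].
      eapply Rle_trans; [exact IH|]. apply Rmult_le_compat_l; [exact HC0|]. apply lsum_le; intros b _.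
      unfold upd; destruct excluded_middle_informative as [->|]; [|lra].
      rewrite Rminus_diag, Rabs_R0; apply Rabs_pos. }
  intros x y. rewrite <- (splice_eq F B L y x HF HB).
  eapply Rle_trans; [apply G; intros k Hk; now rewrite splice_out|].
  apply Rmult_le_compat_l; [exact HC0|]. apply lsum_le; intros k Hk. unfold splice.
  destruct excluded_middle_informative; [lra|contradiction].
Qed.

(** Along a path that raises one coordinate at a time, only the move in coordinate [i] can raise
    [F]. It is applied to [F = pd (S j) i], where the sign hypothesis is the twist condition (D) and
    [C] comes from (E). *)
Lemma pd_nonpos_antitone {d} (F : Config d -> R) B L i C :
  depends_only F B -> (forall k, B k -> In k L) -> (forall j z, has_pd F j z) ->
  (forall k z, k <> i -> pd F k z <= 0) -> (forall z, pd F i z <= C) -> 0 <= C ->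
  forall x y, (forall k, x k <= y k) -> F y - F x <= C * (y i - x i).
Proof.
  intros HF HB Hd Hneg HC HC0.
  assert (G : forall x y, (forall k, ~ In k L -> x k = y k) ->
     (forall k, x k <= y k) -> F y - F x <= C * (y i - x i)).
  { apply (coordinate_path_ind (fun x y L => (forall k, x k <= y k) -> F y - F x <= C * (y i - x i))).
    - intros x _; lra.
    - clear L HB. intros x y a L IH Hxy.
      assert (Hy : F y - F (upd x a (y a)) <= C * (y i - upd x a (y a) i)).
      { apply IH. intros k. unfold upd; destruct excluded_middle_informative as [->|]; [lra|auto]. }
      destruct (pd_mean_value F a x (y a) (Hd a)) as [z Hz]. specialize (Hxy a).
      destruct (classic (a = i)) as [->|Ha].
      + rewrite upd_same in Hy. specialize (HC z).
        assert (pd F i z * (y i - x i) <= C * (y i - x i)) by (apply Rmult_le_compat_r; lra). lra.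
      + rewrite upd_other in Hy by auto. specialize (Hneg a z Ha).
        assert (pd F a z * (y a - x a) <= 0 * (y a - x a)) by (apply Rmult_le_compat_r; lra). lra. }
  intros x y Hxy. rewrite <- (splice_eq F B L y x HF HB).
  eapply Rle_trans; [apply G; [intros k Hk; now rewrite splice_out|]|].
  - intros k; unfold splice; destruct excluded_middle_informative; [auto|lra].
  - apply Rmult_le_compat_l; [exact HC0|]. unfold splice; destruct excluded_middle_informative; [lra|].
    specialize (Hxy i); lra.
Qed.

(* Antitonicity is used at the intermediate configuration [upd x k (y k)]; no symmetry of second derivatives is involved. *)
Lemma pd_neg_strict {d} (F : Config d -> R) B L i k C :
  depends_only F B -> (forall k, B k -> In k L) -> (forall j z, has_pd F j z) ->
  (forall j z, j <> i -> pd F j z <= 0) -> (forall z, pd F i z <= C) -> 0 <= C ->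
  (forall z, pd F k z < 0) -> k <> i ->
  forall x y, (forall j, x j <= y j) -> x i = y i -> F x = F y -> x k = y k.
Proof.
  intros HF HB Hd Hneg HC HC0 Hk Hki x y Hxy Hi HFxy.
  destruct (Rle_lt_or_eq_dec (x k) (y k) (Hxy k)) as [Hlt|]; [exfalso|assumption].
  destruct (pd_mean_value F k x (y k) (Hd k)) as [z Hz]. specialize (Hk z).
  assert (pd F k z * (y k - x k) < 0).
  { rewrite <- (Rmult_0_l (y k - x k)). apply Rmult_lt_compat_r; lra. }
  assert (F y - F (upd x k (y k)) <= C * (y i - upd x k (y k) i)).
  { apply (pd_nonpos_antitone F B L i C); auto.
    intros j; unfold upd; destruct excluded_middle_informative as [->|]; [lra|auto]. }
  rewrite upd_other in H0 by auto. rewrite Hi, Rminus_diag, Rmult_0_r in H0. lra.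
Qed.

Section Potential.
Context {d : nat} (S : Pot d) (r : R).
Hypothesis HS : local_potentials S r.

Lemma pot_depends j : depends_only (S j) (ball j r).
Proof. apply HS. Qed.
Lemma pot_has_pd j k x : has_pd (S j) k x.
Proof. apply HS. Qed.
Lemma pot_has_pd2 j i k x : has_pd (pd (S j) k) i x.
Proof. apply HS. Qed.

Lemma pot_translate j l x : S j x = S zero (tau j l x).
Proof. destruct HS as [_ [HB _]]. now rewrite HB, zadd_zero_l. Qed.

Lemma upd_tau (x : Config d) i j l t : upd (tau j l x) (zsub i j) t = tau j l (upd x i (t - IZR l)).
Proof.
  apply functional_extensionality; intros k; unfold upd, tau.
  destruct excluded_middle_informative as [->|H1]; destruct excluded_middle_informative as [H2|H2]; try lra.
  - contradiction H2; apply zadd_zsub.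
  - subst i. contradiction H1. symmetry; apply zsub_zadd.
Qed.

(** Condition (B) and the chain rule for a shift of slope one. All derivatives are thereby reduced
    to those of [S zero], the potential that the [C^1] hypothesis controls; the integer [l] is free
    and can recentre the values of [x]. *)
Lemma pd_translate j l i x : pd (S j) i x = pd (S zero) (zsub i j) (tau j l x).
Proof.
  symmetry; apply pd_eq. unfold tau at 2; rewrite zadd_zsub.
  replace (fun t => S zero (upd (tau j l x) (zsub i j) t)) with
    (comp (fun t => S j (upd x i t)) (fun t => t - IZR l)).
  - rewrite <- (Rmult_1_r (pd (S j) i x)).
    apply (derivable_pt_lim_comp (fun t => t - IZR l) (fun t => S j (upd x i t))).
    + replace 1 with (1 - 0) by lra.
      apply derivable_pt_lim_minus; [apply derivable_pt_lim_id|apply derivable_pt_lim_const].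
    + replace (x i + IZR l - IZR l) with (x i) by lra. apply pd_spec, pot_has_pd.
  - apply functional_extensionality; intros t; unfold comp. now rewrite upd_tau, (pot_translate j l).
Qed.

Lemma pot_pd_lipschitz : exists C, 0 <= C /\ forall j i x y,
  Rabs (pd (S j) i y - pd (S j) i x) <= C * lsum (fun k => Rabs (y k - x k)) (ball_list r j).
Proof.
  destruct HS as [_ [_ [_ [_ [C HC]]]]]. exists C. split.
  - eapply Rle_trans; [apply Rabs_pos|apply (HC zero zero zero (fun _ => 0))].
  - intros j i. apply (pd_bounded_lipschitz (pd (S j) i) (ball j r)).
    + apply pd_depends_only; [apply pot_depends|]. intros; apply pot_has_pd.
    + intros k; apply in_ball_list.
    + intros; apply pot_has_pd2.
    + intros k z; apply HC.
Qed.

Lemma pot_pd_antitone : exists C, 0 <= C /\ forall j i x y, (forall k, x k <= y k) ->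
  pd (S j) i y - pd (S j) i x <= C * (y i - x i).
Proof.
  destruct HS as [_ [_ [_ [[HD _] [C HC]]]]]. exists C.
  assert (0 <= C) by (eapply Rle_trans; [apply Rabs_pos|apply (HC zero zero zero (fun _ => 0))]).
  split; [assumption|].
  intros j i. apply (pd_nonpos_antitone (pd (S j) i) (ball j r) (ball_list r j)); auto.
  - apply pd_depends_only; [apply pot_depends|]. intros; apply pot_has_pd.
  - intros k; apply in_ball_list.
  - intros; apply pot_has_pd2.
  - intros k z Hk; now apply HD.
  - intros z. eapply Rle_trans; [apply Rle_abs|apply HC].
Qed.

(** The twist condition rules out a range too short to reach neighbours: otherwise the derivative of
    [S k] in direction [i] would vanish identically, and so would the mixed derivative that (D)
    makes negative. *)
Lemma pot_neighbour_in_ball (i k : Zd d) : lnorm (zsub k i) = 1%Z -> ball i r k.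
Proof.
  intros Hik. destruct (classic (ball i r k)) as [|Hn]; [assumption|exfalso].
  assert (H : forall z, pd (S k) i z = 0).
  { intros z; apply (pd_not_in _ (ball k r)); [apply pot_depends|]. intros Hb; now apply Hn, ball_sym. }
  destruct HS as [_ [_ [_ [[_ HD] _]]]]. specialize (HD k i (fun _ => 0) Hik).
  unfold pd2 in HD. rewrite (pd_eq (pd (S k) i) k (fun _ => 0) 0) in HD; [lra|].
  replace (fun t => pd (S k) i (upd (fun _ => 0) k t)) with (fct_cte 0); [apply derivable_pt_lim_const|].
  apply functional_extensionality; intros; symmetry; apply H.
Qed.

End Potential.

(** * The gradient field *)

Lemma lsum_bound {A} (f : A -> R) L b : (forall a, In a L -> f a <= b) -> lsum f L <= INR (length L) * b.
Proof. intros H; rewrite <- lsum_const; now apply lsum_le. Qed.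

Lemma lsum_nonpos_eq0 {A} (f : A -> R) L : (forall a, In a L -> f a <= 0) -> lsum f L = 0 ->
  forall a, In a L -> f a = 0.
Proof.
  induction L as [|b L IH]; intros H H0 a Ha; [destruct Ha|]. rewrite lsum_cons in H0.
  assert (lsum f L <= 0).
  { rewrite <- (Rmult_0_r (INR (length L))). apply lsum_bound; intros; apply H; now right. }
  pose proof (H b (or_introl eq_refl)).
  destruct Ha as [<-|Ha]; [lra|]. apply IH; auto; [intros; apply H; now right|lra].
Qed.

Definition ball_card (d : nat) (r : R) : R := INR (length (ball_list r (@zero d))).

Lemma ball_card_nonneg d r : 0 <= ball_card d r.
Proof. apply pos_INR. Qed.

Lemma gradW_lsum {d} (S : Pot d) r x i : gradW S r x i = lsum (fun j => pd (S j) i x) (ball_list r i).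
Proof. apply fsum_ball. Qed.

Section GradW.
Context {d : nat} (S : Pot d) (r : R).
Hypothesis HS : local_potentials S r.

(** The field at [i] sees balls around the points of a ball around [i], hence the range
    [2 * radius r]. The bound [1 <= K] lets the Picard estimates divide by [K]. *)
Lemma gradW_lipschitz : exists K, 1 <= K /\ forall i x y b,
  (forall k, (lnorm (zsub k i) <= Z.of_nat (2 * radius r))%Z -> Rabs (y k - x k) <= b) ->
  Rabs (gradW S r y i - gradW S r x i) <= K * b.
Proof.
  destruct (pot_pd_lipschitz S r HS) as [C [HC0 HC]]. pose proof (ball_card_nonneg d r) as Hn.
  exists (1 + ball_card d r * (C * ball_card d r)). split.
  { assert (0 <= ball_card d r * (C * ball_card d r)) by (repeat apply Rmult_le_pos; auto). lra. }
  intros i x y b Hb.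
  assert (Hb0 : 0 <= b).
  { eapply Rle_trans; [apply Rabs_pos|apply (Hb i)]. rewrite zsub_diag, lnorm_zero; lia. }
  rewrite !gradW_lsum, <- lsum_minus.
  eapply Rle_trans; [apply lsum_abs|].
  apply Rle_trans with (ball_card d r * (C * ball_card d r * b)); [|lra].
  unfold ball_card at 1. rewrite <- (ball_list_length r i). apply lsum_bound.
  intros j Hj. eapply Rle_trans; [apply HC|]. rewrite Rmult_assoc. apply Rmult_le_compat_l; [assumption|].
  unfold ball_card; rewrite <- (ball_list_length r j). apply lsum_bound.
  intros k Hk. apply Hb. apply in_ball_list in Hj, Hk. apply ball_radius in Hj, Hk.
  pose proof (lnorm_zsub_triangle k j i). lia.
Qed.

(** For two ordered solutions with difference [u = y - x], this is the differential inequality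
    [u_i' >= - A * u_i]. *)
Lemma gradW_antitone : exists A, 0 <= A /\ forall i x y, (forall k, x k <= y k) ->
  gradW S r y i - gradW S r x i <= A * (y i - x i).
Proof.
  destruct (pot_pd_antitone S r HS) as [C [HC0 HC]]. exists (ball_card d r * C).
  split; [apply Rmult_le_pos; auto using ball_card_nonneg|].
  intros i x y Hxy. rewrite !gradW_lsum, <- lsum_minus, Rmult_assoc.
  unfold ball_card. rewrite <- (ball_list_length r i). apply lsum_bound. intros j _; now apply HC.
Qed.

(** When [x i = y i], every summand of the difference of the fields is nonpositive, so a vanishing
    sum makes each of them vanish. The summand of [S k] is the useful one: the strict part of (D)
    concerns its derivative in the directions [k] and [i]. *)
Lemma gradW_strict i k x y : (forall m, x m <= y m) -> x i = y i -> gradW S r x i = gradW S r y i ->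
  lnorm (zsub k i) = 1%Z -> x k = y k.
Proof.
  intros Hxy Hi Hg Hik. destruct (pot_pd_antitone S r HS) as [C [HC0 HC]].
  assert (Hk : pd (S k) i y - pd (S k) i x = 0).
  { apply (lsum_nonpos_eq0 (fun j => pd (S j) i y - pd (S j) i x) (ball_list r i)).
    - intros j _. specialize (HC j i x y Hxy). rewrite Hi, Rminus_diag, Rmult_0_r in HC. exact HC.
    - rewrite lsum_minus, <- !gradW_lsum, Hg. lra.
    - apply in_ball_list. now apply (pot_neighbour_in_ball S r HS). }
  destruct HS as [_ [_ [_ [[HD HD'] [B HB]]]]].
  apply (pd_neg_strict (pd (S k) i) (ball k r) (ball_list r k) i k B); auto.
  - apply pd_depends_only; [apply (pot_depends S r HS)|]. intros; apply (pot_has_pd S r HS).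
  - intros m; apply in_ball_list.
  - intros; apply (pot_has_pd2 S r HS).
  - intros j z Hj; now apply HD.
  - intros z. eapply Rle_trans; [apply Rle_abs|apply HB].
  - eapply Rle_trans; [apply Rabs_pos|apply (HB zero zero zero x)].
  - intros z; now apply HD'.
  - intros ->. rewrite zsub_diag, lnorm_zero in Hik. discriminate.
  - lra.
Qed.

(* An integer vertical translation brings [x j] within distance 1 of 0 without changing the derivatives. *)
Lemma gradW_bounded x W : 0 <= W ->
  (forall j m, Rabs (x (zadd j m) - x j) <= 1 + W * IZR (lnorm m)) ->
  exists M, 0 <= M /\ forall i, Rabs (gradW S r x i) <= M.
Proof.
  intros HW Hx. destruct (pot_pd_lipschitz S r HS) as [C [HC0 HC]]. pose proof (ball_card_nonneg d r) as Hn.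
  set (P := lsum (fun k => Rabs (pd (S zero) k (fun _ => 0))) (ball_list r zero)).
  (* One unit comes from the recentred value at [j]; the remaining [1 + W * radius] is the growth of
     [x] across the ball around [j]. *)
  set (D := 2 + W * IZR (Z.of_nat (radius r))).
  assert (HP : 0 <= P) by (apply lsum_nonneg; intros; apply Rabs_pos).
  assert (HD : 0 <= D).
  { unfold D. assert (0 <= W * IZR (Z.of_nat (radius r))); [|lra].
    apply Rmult_le_pos; [assumption|]. apply IZR_le; lia. }
  exists (ball_card d r * (P + C * (ball_card d r * D))). split.
  { apply Rmult_le_pos; [assumption|]. apply Rplus_le_le_0_compat; [assumption|].
    apply Rmult_le_pos; [assumption|]. now apply Rmult_le_pos. }
  intros i. rewrite gradW_lsum. eapply Rle_trans; [apply lsum_abs|].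
  unfold ball_card at 1. rewrite <- (ball_list_length r i). apply lsum_bound. intros j Hj.
  set (l := (- up (x j))%Z). rewrite (pd_translate S r HS j l).
  assert (Hl : Rabs (x j + IZR l) <= 1).
  { unfold l; rewrite opp_IZR. pose proof (archimed (x j)). apply Rabs_le; lra. }
  set (k := zsub i j). set (z := tau j l x).
  replace (pd (S zero) k z) with (pd (S zero) k (fun _ => 0) + (pd (S zero) k z - pd (S zero) k (fun _ => 0))) by lra.
  eapply Rle_trans; [apply Rabs_triang|]. apply Rplus_le_compat.
  - apply (lsum_single (fun k => Rabs (pd (S zero) k (fun _ => 0)))); [intros; apply Rabs_pos|].
    apply in_ball_list. unfold ball, k. rewrite zsub_zero_r, lnorm_zsub_sym.
    apply in_ball_list in Hj. exact Hj.
  - eapply Rle_trans; [apply HC|]. apply Rmult_le_compat_l; [assumption|].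
    unfold ball_card. apply lsum_bound. intros m Hm. unfold z, tau. rewrite Rminus_0_r.
    specialize (Hx j m). rewrite zadd_comm in Hx.
    replace (x (zadd m j) + IZR l) with ((x (zadd m j) - x j) + (x j + IZR l)) by lra.
    eapply Rle_trans; [apply Rabs_triang|].
    apply in_ball_list, ball_radius in Hm. rewrite zsub_zero_r in Hm. apply IZR_le in Hm.
    assert (W * IZR (lnorm m) <= W * IZR (Z.of_nat (radius r))) by (apply Rmult_le_compat_l; auto).
    unfold D; lra.
Qed.

End GradW.

Lemma C1norm_pd_le {d} (F : Config d -> R) eps : C1norm_grad_le F eps -> forall k x, Rabs (pd F k x) <= eps.
Proof.
  intros H k x. specialize (H ((k, x) :: nil) nil).
  cbn in H. rewrite !Rplus_0_r in H. apply H; repeat constructor; auto.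
Qed.

Lemma gradW_close {d} (S S' : Pot d) r eps : local_potentials S r -> local_potentials S' r ->
  C1norm_grad_le (fun x => S zero x - S' zero x) eps ->
  forall x i, Rabs (gradW S r x i - gradW S' r x i) <= ball_card d r * eps.
Proof.
  intros HS HS' H x i. rewrite !gradW_lsum, <- lsum_minus.
  eapply Rle_trans; [apply lsum_abs|]. unfold ball_card; rewrite <- (ball_list_length r i).
  apply lsum_bound. intros j _. rewrite (pd_translate S r HS j 0), (pd_translate S' r HS' j 0), <- pd_minus.
  - now apply C1norm_pd_le.
  - apply (pot_has_pd S r HS).
  - apply (pot_has_pd S' r HS').
Qed.

(** * Estimates for functions of one variable *)

Lemma continuous_primitive (f : R -> R) : (forall t, continuity_pt f t) ->
  exists P, P 0 = 0 /\ forall t, derivable_pt_lim P t (f t).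
Proof.
  intros Hf. exists (fun t => @Coquelicot.RInt.RInt Coquelicot.Hierarchy.R_CompleteNormedModule f 0 t). split.
  - apply (@Coquelicot.RInt.RInt_point Coquelicot.Hierarchy.R_CompleteNormedModule).
  - intros t. apply Coquelicot.Derive.is_derive_Reals, (@Coquelicot.RInt_analysis.is_derive_RInt Coquelicot.Hierarchy.R_NormedModule f _ 0 t).
    + apply Coquelicot.Hierarchy.filter_forall. intros b.
      apply (@Coquelicot.RInt.RInt_correct Coquelicot.Hierarchy.R_CompleteNormedModule f), Coquelicot.RInt.ex_RInt_continuous.
      intros z _. apply Coquelicot.Hierarchy.continuity_pt_filterlim, Hf.
    + apply Coquelicot.Hierarchy.continuity_pt_filterlim, Hf.
Qed.

(** [phi] will be a supremum over sites, which need not be differentiable, so the hypothesis bounds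
    its increments instead. The barrier [E = K * exp ((L + 1) * t)] satisfies [E' = L * E + E], and
    the surplus [E >= K] absorbs the source term [c < K]. *)
Lemma gronwall_pos (phi : R -> R) L c K : 0 <= L -> 0 <= c < K -> phi 0 < K ->
  (forall t eps, 0 < eps -> exists delta, 0 < delta /\ forall h, Rabs h < delta ->
      Rabs (phi (t + h) - phi t) <= Rabs h * (L * phi t + c + eps)) ->
  forall t, 0 <= t -> phi t < K * exp ((L + 1) * t).
Proof.
  intros HL Hc H0 Hphi T HT. apply Rnot_le_lt; intros Hbad.
  set (E := fun t => K * exp ((L + 1) * t)).
  assert (EK : forall t, 0 <= t -> K <= E t).
  { intros t Ht. unfold E. assert (0 <= (L + 1) * t) by (apply Rmult_le_pos; lra).
    pose proof (exp_ineq1_le ((L + 1) * t)).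
    rewrite <- (Rmult_1_r K) at 1. apply Rmult_le_compat_l; lra. }
  assert (Eh : forall t a, 0 <= a -> E t * (1 + (L + 1) * a) <= E (t + a)).
  { intros t a Ha. unfold E. rewrite (Rmult_plus_distr_l (L + 1) t a), exp_plus, Rmult_assoc.
    apply Rmult_le_compat_l; [lra|]. apply Rmult_le_compat_l; [left; apply exp_pos|]. apply exp_ineq1_le. }
  (* [s] is the supremum of the times up to which [phi] stays strictly below the barrier. *)
  destruct (completeness (fun s => 0 <= s <= T /\ forall u, 0 <= u <= s -> phi u < E u)) as [s [Hub Hlub]].
  { exists T; intros s [Hs _]; lra. }
  { exists 0; split; [lra|]. intros u Hu. replace u with 0 by lra.
    eapply Rlt_le_trans; [exact H0|]. apply EK; lra. }
  assert (Hs0 : 0 <= s).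
  { apply Hub. split; [lra|]. intros u Hu. replace u with 0 by lra.
    eapply Rlt_le_trans; [exact H0|]. apply EK; lra. }
  assert (HsT : s <= T) by (apply Hlub; intros u [Hu _]; lra).
  assert (Hbelow : forall u, 0 <= u < s -> phi u < E u).
  { intros u Hu. destruct (classic (exists v, (0 <= v <= T /\ forall w, 0 <= w <= v -> phi w < E w) /\ u < v))
      as [[v [[_ Hv] Huv]]|Hn]; [apply Hv; lra|].
    exfalso. apply (Rlt_not_le s u); [lra|]. apply Hlub. intros v Hv. apply Rnot_lt_le; intros Huv. eauto. }
  (* A strict inequality at [s] would persist on some [[s, s + a]], since [E] does not decrease and
     [phi] moves by at most [a * M]. *)
  assert (Hs : E s <= phi s).
  { apply Rnot_lt_le; intros Hlt.
    assert (s < T). { destruct HsT as [|HsT]; [assumption|]. exfalso; subst; unfold E in Hlt; lra. }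
    destruct (Hphi s 1 Rlt_0_1) as [delta [Hd Hh]].
    set (M := Rabs (L * phi s + c + 1) + 1).
    assert (HM : 1 <= M) by (unfold M; pose proof (Rabs_pos (L * phi s + c + 1)); lra).
    set (a := Rmin (Rmin (delta / 2) (T - s)) ((E s - phi s) / (2 * M))).
    assert (Ha : 0 < a). { unfold a. repeat apply Rmin_glb_lt; try lra. apply Rdiv_lt_0_compat; lra. }
    assert (a <= delta / 2) by (unfold a; eapply Rle_trans; [apply Rmin_l|apply Rmin_l]).
    assert (a <= T - s) by (unfold a; eapply Rle_trans; [apply Rmin_l|apply Rmin_r]).
    assert (HaM : a * M <= (E s - phi s) / 2).
    { assert (a <= (E s - phi s) / (2 * M)) by apply Rmin_r.
      replace ((E s - phi s) / 2) with ((E s - phi s) / (2 * M) * M) by (field; lra).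
      apply Rmult_le_compat_r; lra. }
    assert (s + a <= s); [|lra]. apply Hub. split; [lra|]. intros u Hu.
    destruct (Rlt_le_dec u s) as [|Hus]; [apply Hbelow; lra|].
    assert (Hu' : Rabs (u - s) = u - s) by (apply Rabs_pos_eq; lra).
    specialize (Hh (u - s)). rewrite Hu' in Hh. replace (s + (u - s)) with u in Hh by lra.
    assert (Hh' := Hh ltac:(lra)). pose proof (Rle_abs (phi u - phi s)).
    assert ((u - s) * (L * phi s + c + 1) <= a * M).
    { apply Rle_trans with ((u - s) * M); [|apply Rmult_le_compat_r; lra].
      apply Rmult_le_compat_l; [lra|]. unfold M. pose proof (Rle_abs (L * phi s + c + 1)). lra. }
    pose proof (Eh s (u - s) ltac:(lra)) as HE. replace (s + (u - s)) with u in HE by lra.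
    assert (0 <= E s * ((L + 1) * (u - s))).
    { apply Rmult_le_pos; [pose proof (EK s Hs0); lra|]. apply Rmult_le_pos; lra. }
    lra. }
  assert (0 < s).
  { destruct Hs0 as [|<-]; [assumption|]. pose proof (EK 0 (Rle_refl _)). unfold E in *.
    rewrite Rmult_0_r, exp_0 in *. lra. }
  (* Look back from [s] by a small [a]. Once the common rate [L] is removed, the barrier gains
     [a * K] up to higher order, but [phi] at most [a * (c + eps)]; half of the gap [K - c] leaves
     room for the error. *)
  set (eps := (K - c) / 2). assert (Heps : 0 < eps) by (unfold eps; lra).
  destruct (Hphi s eps Heps) as [delta [Hd Hh]].
  (* [Q] dominates the error coefficients [L], [(L + 1) * L] and [K * ((L + 1) * L)]
     simultaneously. *)
  set (Q := (K + 1) * ((L + 1) * L) + L + 1).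
  assert (HLL : 0 <= (L + 1) * L) by (apply Rmult_le_pos; lra).
  assert (HKL : 0 <= K * ((L + 1) * L)) by (apply Rmult_le_pos; lra).
  assert (HQ : 1 <= Q) by (unfold Q; lra).
  set (a := Rmin (Rmin (delta / 2) s) (Rmin (eps / Q) (1 / (2 * Q)))).
  assert (Ha : 0 < a).
  { unfold a. repeat apply Rmin_glb_lt; try lra; apply Rdiv_lt_0_compat; lra. }
  assert (a <= delta / 2) by (unfold a; eapply Rle_trans; [apply Rmin_l|apply Rmin_l]).
  assert (a <= s) by (unfold a; eapply Rle_trans; [apply Rmin_l|apply Rmin_r]).
  assert (HaQ : a * Q <= eps).
  { assert (a <= eps / Q) by (unfold a; eapply Rle_trans; [apply Rmin_r|apply Rmin_l]).
    replace eps with (eps / Q * Q) by (field; lra). apply Rmult_le_compat_r; lra. }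
  assert (HaQ' : a * Q <= / 2).
  { assert (a <= 1 / (2 * Q)) by (unfold a; eapply Rle_trans; [apply Rmin_r|apply Rmin_r]).
    replace (/ 2) with (1 / (2 * Q) * Q) by (field; lra). apply Rmult_le_compat_r; lra. }
  specialize (Hh (- a)). rewrite Rabs_Ropp, (Rabs_pos_eq a) in Hh by lra. specialize (Hh ltac:(lra)).
  assert (Hsa : phi (s + - a) < E (s + - a)) by (apply Hbelow; lra).
  pose proof (EK (s + - a) ltac:(lra)) as HKa.
  pose proof (Eh (s + - a) a ltac:(lra)) as HE. replace (s + - a + a) with s in HE by lra.
  rewrite Rabs_minus_sym in Hh. pose proof (Rle_abs (phi s - phi (s + - a))).
  set (e := E (s + - a)) in *.
  assert (HaL : a * L <= / 2).
  { apply Rle_trans with (a * Q); [|assumption]. apply Rmult_le_compat_l; [lra|]. unfold Q; lra. }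
  assert (HaLL : a * ((L + 1) * L) <= / 2).
  { apply Rle_trans with (a * Q); [|assumption]. apply Rmult_le_compat_l; [lra|]. unfold Q; lra. }
  assert (HaKL : a * (K * ((L + 1) * L)) < eps).
  { apply Rlt_le_trans with (a * Q); [|assumption]. apply Rmult_lt_compat_l; [lra|]. unfold Q; lra. }
  assert (HP1 : e * (1 + (L + 1) * a) * (1 - a * L) <= phi s * (1 - a * L)).
  { apply Rmult_le_compat_r; lra. }
  assert (HP2 : a * (e * (1 - a * ((L + 1) * L))) < a * (c + eps)) by lra.
  apply Rmult_lt_reg_l in HP2; [|assumption].
  assert (K * (1 - a * ((L + 1) * L)) <= e * (1 - a * ((L + 1) * L))) by (apply Rmult_le_compat_r; lra).
  unfold eps in *. lra.
Qed.

(** The hypothesis is symmetric in the sign of [h], so negative times follow by reversing time. *)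
Lemma gronwall (phi : R -> R) L c K : 0 <= L -> 0 <= c < K -> phi 0 < K ->
  (forall t eps, 0 < eps -> exists delta, 0 < delta /\ forall h, Rabs h < delta ->
      Rabs (phi (t + h) - phi t) <= Rabs h * (L * phi t + c + eps)) ->
  forall t, phi t < K * exp ((L + 1) * Rabs t).
Proof.
  intros HL Hc H0 Hphi t. destruct (Rle_lt_dec 0 t) as [Ht|Ht].
  - rewrite Rabs_pos_eq by assumption. now apply (gronwall_pos phi L c K).
  - rewrite Rabs_left by assumption.
    replace (phi t) with ((fun s => phi (- s)) (- t)) by (cbn; now rewrite Ropp_involutive).
    apply (gronwall_pos (fun s => phi (- s)) L c K); auto; [now rewrite Ropp_0| |lra].
    intros s eps Heps. destruct (Hphi (- s) eps Heps) as [delta [Hd Hh]]. exists delta; split; [assumption|].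
    intros h Hhd. rewrite Ropp_plus_distr, <- (Rabs_Ropp h). apply Hh. now rewrite Rabs_Ropp.
Qed.

(** [a / lam * exp (lam * t)] is a primitive of the bound on [f'], so its difference with [f] does
    not decrease, and it starts at [a / lam >= 0]. *)
Lemma exp_bounded_primitive_pos (f f' : R -> R) a lam : 0 <= a -> 0 < lam -> f 0 = 0 ->
  (forall s, derivable_pt_lim f s (f' s)) -> (forall s, Rabs (f' s) <= a * exp (lam * Rabs s)) ->
  forall t, 0 <= t -> f t <= a / lam * exp (lam * t).
Proof.
  intros Ha Hlam H0 Hf Hb t Ht.
  assert (Hq : 0 <= a / lam) by (apply Rmult_le_pos; [|left; apply Rinv_0_lt_compat]; assumption).
  destruct (mean_value (fun s => a / lam * exp (lam * s) - f s)
    (fun s => a / lam * (exp (lam * s) * lam) - f' s) 0 t) as [c [Hc He]].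
  - intros s. apply derivable_pt_lim_minus; [|apply Hf].
    apply (derivable_pt_lim_scal (fun s => exp (lam * s))).
    apply (derivable_pt_lim_comp (fun s => lam * s) exp); [|apply derivable_pt_lim_exp].
    pose proof (derivable_pt_lim_scal id lam s 1 (derivable_pt_lim_id s)) as D.
    rewrite Rmult_1_r in D; exact D.
  - rewrite Rmin_left, Rmax_right in Hc by lra.
    specialize (Hb c). rewrite (Rabs_pos_eq c) in Hb by lra.
    pose proof (Rle_abs (f' c)).
    replace (a / lam * (exp (lam * c) * lam)) with (a * exp (lam * c)) in He by (field; lra).
    assert (0 <= (a * exp (lam * c) - f' c) * (t - 0)) by (apply Rmult_le_pos; lra).
    rewrite Rmult_0_r, exp_0, H0 in He. lra.
Qed.

Lemma exp_bounded_primitive (f f' : R -> R) a lam : 0 <= a -> 0 < lam -> f 0 = 0 ->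
  (forall s, derivable_pt_lim f s (f' s)) -> (forall s, Rabs (f' s) <= a * exp (lam * Rabs s)) ->
  forall t, Rabs (f t) <= a / lam * exp (lam * Rabs t).
Proof.
  assert (Hpos : forall (f f' : R -> R) a lam, 0 <= a -> 0 < lam -> f 0 = 0 ->
    (forall s, derivable_pt_lim f s (f' s)) -> (forall s, Rabs (f' s) <= a * exp (lam * Rabs s)) ->
    forall t, 0 <= t -> Rabs (f t) <= a / lam * exp (lam * t)).
  { clear; intros f f' a lam Ha Hlam H0 Hf Hb t Ht. apply Rabs_le; split.
    - enough (- f t <= a / lam * exp (lam * t)) by lra.
      apply (exp_bounded_primitive_pos (fun s => - f s) (fun s => - f' s)); auto.
      + rewrite H0; lra.
      + intros s; now apply derivable_pt_lim_opp.
      + intros s; now rewrite Rabs_Ropp.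
    - now apply (exp_bounded_primitive_pos f f'). }
  intros Ha Hlam H0 Hf Hb t. destruct (Rle_lt_dec 0 t) as [Ht|Ht].
  - rewrite (Rabs_pos_eq t) by assumption. now apply (Hpos f f').
  - rewrite (Rabs_left t) by assumption.
    replace (f t) with ((fun s => f (- s)) (- t)) by (cbn; now rewrite Ropp_involutive).
    apply (Hpos (fun s => f (- s)) (fun s => f' (- s) * - (1))); auto; [now rewrite Ropp_0| | |lra].
    + intros s. apply (derivable_pt_lim_comp Ropp f); [|apply Hf].
      apply derivable_pt_lim_opp, derivable_pt_lim_id.
    + intros s. rewrite Rabs_mult, (Rabs_Ropp 1), Rabs_R1, Rmult_1_r, <- (Rabs_Ropp s). apply Hb.
Qed.

(** The intervals with centre [u n] and radius [2 * a * (/2)^n] are nested; [l] is the supremum of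
    their left ends. *)
Lemma geometric_limit (u : nat -> R) a : 0 <= a ->
  (forall n, Rabs (u (S n) - u n) <= a * (/2)^n) -> exists l, forall n, Rabs (l - u n) <= 2 * a * (/2)^n.
Proof.
  intros Ha Hu. assert (Hp : forall n, 0 <= (/2)^n) by (intros; apply pow_le; lra).
  assert (Hv : forall n p, u n - 2 * a * (/2)^n <= u (n + p)%nat - 2 * a * (/2)^(n + p)).
  { induction p; [rewrite Nat.add_0_r; lra|]. eapply Rle_trans; [exact IHp|].
    rewrite Nat.add_succ_r; cbn [pow]. pose proof (Hu (n + p)%nat) as H. apply Coquelicot.Rcomplements.Rabs_le_between in H. lra. }
  assert (Hw : forall n p, u (n + p)%nat + 2 * a * (/2)^(n + p) <= u n + 2 * a * (/2)^n).
  { induction p; [rewrite Nat.add_0_r; lra|]. eapply Rle_trans; [|exact IHp].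
    rewrite Nat.add_succ_r; cbn [pow]. pose proof (Hu (n + p)%nat) as H. apply Coquelicot.Rcomplements.Rabs_le_between in H. lra. }
  assert (Hvw : forall n m, u n - 2 * a * (/2)^n <= u m + 2 * a * (/2)^m).
  { intros n m. specialize (Hv n m). specialize (Hw m n). rewrite (Nat.add_comm m n) in Hw.
    assert (0 <= 2 * a * (/2)^(n + m)) by (repeat apply Rmult_le_pos; auto; lra). lra. }
  destruct (completeness (fun r => exists n, r = u n - 2 * a * (/2)^n)) as [l [Hub Hlub]].
  { exists (u O + 2 * a * (/2)^0). intros r [n ->]. apply Hvw. }
  { exists (u O - 2 * a * (/2)^0). now exists O. }
  exists l. intros n. apply Rabs_le; split.
  - specialize (Hub (u n - 2 * a * (/2)^n) (ex_intro _ n eq_refl)). lra.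
  - assert (l <= u n + 2 * a * (/2)^n); [|lra]. apply Hlub. intros r [m ->]. apply Hvw.
Qed.

(** * The Picard-Lindelof theorem *)

Section Picard.
Context {d : nat} (F : Config d -> Config d) (x0 : Config d) (K M : R).
Hypothesis HK : 1 <= K.
Hypothesis HM : 0 <= M.
Hypothesis F_lip : forall x y b, (forall k, Rabs (y k - x k) <= b) -> forall i, Rabs (F y i - F x i) <= K * b.
Hypothesis F_bdd : forall i, Rabs (F x0 i) <= M.

Let ex t := exp (2 * K * Rabs t).

Let ex_ge1 t : 1 <= ex t.
Proof.
  unfold ex. assert (0 <= 2 * K * Rabs t) by (apply Rmult_le_pos; [lra|apply Rabs_pos]).
  pose proof (exp_ineq1_le (2 * K * Rabs t)). lra.
Qed.

Let ex_mono s t : Rabs s <= t -> ex s <= ex t.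
Proof.
  intros H. unfold ex. rewrite (Rabs_pos_eq t) by (pose proof (Rabs_pos s); lra).
  assert (2 * K * Rabs s <= 2 * K * t) as [Hl|Heq] by (apply Rmult_le_compat_l; lra);
    [left; now apply exp_increasing|right; now rewrite Heq].
Qed.

(** [F_lip] takes a bound on all coordinates at once, so continuity of [F (g s) i] in [s] asks for
    continuity of [g] uniform over the sites. *)
Definition equicontinuous (g : R -> Config d) : Prop :=
  forall t eps, 0 < eps -> exists delta, 0 < delta /\
    forall s, Rabs (s - t) < delta -> forall k, Rabs (g s k - g t k) <= eps.

(* The weight [exp (2 K |t|)] makes the Picard operator a contraction of ratio 1/2 on the whole time axis. *)
Let good (g : R -> Config d) : Prop :=
  equicontinuous g /\ forall t i, Rabs (g t i - x0 i) <= 2 * M * ex t.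

Let step_rel (g g' : R -> Config d) : Prop :=
  g' 0 = x0 /\ forall t i, derivable_pt_lim (fun s => g' s i) t (F (g t) i).

Let good_field g : good g -> forall t i, Rabs (F (g t) i) <= (M + 2 * K * M) * ex t.
Proof.
  intros [_ Hg] t i. replace (F (g t) i) with (F x0 i + (F (g t) i - F x0 i)) by lra.
  eapply Rle_trans; [apply Rabs_triang|].
  pose proof (F_lip x0 (g t) _ (Hg t) i). specialize (F_bdd i). pose proof (ex_ge1 t).
  assert (M * 1 <= M * ex t) by (apply Rmult_le_compat_l; lra). lra.
Qed.

Let picard_bound (f f' : R -> R) a : 0 <= a -> f 0 = 0 ->
  (forall s, derivable_pt_lim f s (f' s)) -> (forall s, Rabs (f' s) <= K * a * ex s) ->
  forall t, Rabs (f t) <= a / 2 * ex t.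
Proof.
  intros Ha H0 Hf Hb t. replace (a / 2) with (K * a / (2 * K)) by (field; lra).
  apply (exp_bounded_primitive f f'); auto; [|lra]. apply Rmult_le_pos; lra.
Qed.

Let equicontinuous_of_derivative (g : R -> Config d) (f : R -> Config d) B : 0 <= B ->
  (forall t i, derivable_pt_lim (fun s => g s i) t (f t i)) ->
  (forall t i, Rabs (f t i) <= B * ex t) ->
  forall t s i, Rabs (s - t) <= 1 -> Rabs (g s i - g t i) <= Rabs (s - t) * (B * ex (Rabs t + 1)).
Proof.
  intros HB Hd Hf t s i Hst.
  destruct (mean_value (fun s => g s i) (fun s => f s i) t s) as [c [Hc ->]]; [intros; apply Hd|].
  rewrite Rabs_mult, Rmult_comm. apply Rmult_le_compat_l; [apply Rabs_pos|].
  eapply Rle_trans; [apply Hf|]. apply Rmult_le_compat_l; [assumption|]. apply ex_mono.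
  unfold Rmin, Rmax in Hc. unfold Rabs in *. repeat destruct Rle_dec; repeat destruct Rcase_abs; lra.
Qed.

Let picard_step g : good g -> exists g', good g' /\ step_rel g g'.
Proof.
  intros Hg. pose proof (good_field g Hg) as HF.
  assert (HB : 0 <= M + 2 * K * M).
  { assert (0 <= 2 * K * M) by (repeat apply Rmult_le_pos; lra). lra. }
  assert (Hc : forall i t, continuity_pt (fun s => F (g s) i) t).
  { intros i t eps Heps. destruct (proj1 Hg t (eps / (2 * K))) as [delta [Hd H]].
    { apply Rdiv_lt_0_compat; lra. }
    exists delta; split; [assumption|]. intros s [_ Hs].
    change (Rabs (F (g s) i - F (g t) i) < eps).
    eapply Rle_lt_trans; [apply (F_lip _ _ (eps / (2 * K))); intros k; apply H; exact Hs|].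
    replace (K * (eps / (2 * K))) with (eps / 2) by (field; lra). lra. }
  pose (P := fun i => epsilon (inhabits (fun _ : R => 0))
    (fun P => P 0 = 0 /\ forall t, derivable_pt_lim P t (F (g t) i))).
  assert (HP : forall i, P i 0 = 0 /\ forall t, derivable_pt_lim (P i) t (F (g t) i)).
  { intros i. apply epsilon_spec. apply (continuous_primitive (fun t => F (g t) i)), Hc. }
  assert (HD : forall t i, derivable_pt_lim (fun s => x0 i + P i s) t (F (g t) i)).
  { intros t i. rewrite <- (Rplus_0_l (F (g t) i)).
    apply (derivable_pt_lim_plus (fct_cte (x0 i)) (P i)); [apply derivable_pt_lim_const|apply HP]. }
  exists (fun t i => x0 i + P i t). split; [split|split].
  - intros t eps Heps. set (B := (M + 2 * K * M) * ex (Rabs t + 1)).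
    assert (HB' : 0 <= B) by (apply Rmult_le_pos; [assumption|pose proof (ex_ge1 (Rabs t + 1)); lra]).
    exists (Rmin 1 (eps / (B + 1))). split.
    { apply Rmin_glb_lt; [lra|apply Rdiv_lt_0_compat; lra]. }
    intros s Hs k.
    assert (Hs1 : Rabs (s - t) <= 1) by (pose proof (Rmin_l 1 (eps / (B + 1))); lra).
    assert (Hs2 : Rabs (s - t) <= eps / (B + 1)) by (pose proof (Rmin_r 1 (eps / (B + 1))); lra).
    eapply Rle_trans; [apply (equicontinuous_of_derivative (fun t i => x0 i + P i t) (fun t i => F (g t) i)
      (M + 2 * K * M)); auto|]. fold B.
    apply Rle_trans with (eps / (B + 1) * (B + 1)); [|right; field; lra].
    apply Rmult_le_compat; try lra. apply Rabs_pos.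
  - intros t i. replace (x0 i + P i t - x0 i) with (P i t) by lra.
    (* [a = M / K + 2 * M] makes [K * a] equal to the bound of [good_field]. As [K >= 1], its half
       is at most [2 * M], so the Picard step preserves [good]. *)
    eapply Rle_trans; [apply (picard_bound (P i) (fun t => F (g t) i) (M / K + 2 * M)); try apply HP|].
    + assert (0 <= M / K) by (apply Rmult_le_pos; [lra|left; apply Rinv_0_lt_compat; lra]). lra.
    + intros s. replace (K * (M / K + 2 * M)) with (M + 2 * K * M) by (field; lra). apply HF.
    + apply Rmult_le_compat_r; [pose proof (ex_ge1 t); lra|].
      assert (M / K <= M).
      { unfold Rdiv. rewrite <- (Rmult_1_r M) at 2. apply Rmult_le_compat_l; [lra|].
        rewrite <- Rinv_1. apply Rinv_le_contravar; lra. }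
      lra.
  - apply functional_extensionality; intros i. rewrite (proj1 (HP i)). lra.
  - exact HD.
Qed.

Let step (g : R -> Config d) : R -> Config d :=
  epsilon (inhabits g) (fun g' => good g' /\ step_rel g g').

Let step_spec g : good g -> good (step g) /\ step_rel g (step g).
Proof. intros Hg. unfold step. apply epsilon_spec. now apply picard_step. Qed.

Let iterate := fix iterate (n : nat) : R -> Config d :=
  match n with O => fun _ => x0 | S n => step (iterate n) end.

Let ex_M t n : 0 <= M * (/2)^n * ex t.
Proof.
  apply Rmult_le_pos; [|pose proof (ex_ge1 t); lra]. apply Rmult_le_pos; [lra|]. apply pow_le; lra.
Qed.

Let iterate_good n : good (iterate n).
Proof.
  induction n; [|cbn; now apply step_spec]. split.
  - intros t eps Heps. exists 1; split; [lra|]. intros s _ k. cbn. rewrite Rminus_diag, Rabs_R0; lra.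
  - intros t i; cbn. rewrite Rminus_diag, Rabs_R0. pose proof (ex_M t 0). cbn in *; lra.
Qed.

Let iterate_step n : step_rel (iterate n) (iterate (S n)).
Proof. apply (step_spec (iterate n)), iterate_good. Qed.

Let step_close g g' h h' a : 0 <= a -> step_rel g g' -> step_rel h h' ->
  (forall t i, Rabs (g t i - h t i) <= a * ex t) -> forall t i, Rabs (g' t i - h' t i) <= a / 2 * ex t.
Proof.
  intros Ha [H0 Hg] [H0' Hh] Hgh t i.
  apply (picard_bound (fun t => g' t i - h' t i) (fun t => F (g t) i - F (h t) i)); auto.
  - rewrite H0, H0'. lra.
  - intros s. now apply (derivable_pt_lim_minus (fun t => g' t i) (fun t => h' t i)).
  - intros s. rewrite Rmult_assoc. now apply F_lip.
Qed.

Let iterate_close n : forall t i, Rabs (iterate (S n) t i - iterate n t i) <= M * (/2)^n * ex t.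
Proof.
  induction n; intros t i.
  - destruct (iterate_step 0) as [H0 Hd]. cbn [iterate] in *. rewrite pow_O, Rmult_1_r.
    eapply Rle_trans; [apply (picard_bound (fun t => step (fun _ => x0) t i - x0 i) (fun _ => F x0 i) M)|]; auto.
    + rewrite H0; lra.
    + intros s. rewrite <- (Rminus_0_r (F x0 i)).
      apply (derivable_pt_lim_minus (fun t => step (fun _ => x0) t i) (fct_cte (x0 i)));
        [apply Hd|apply derivable_pt_lim_const].
    + intros s. specialize (F_bdd i). eapply Rle_trans; [exact F_bdd|]. pose proof (ex_ge1 s).
      assert (M * 1 <= K * M * ex s); [|lra]. apply Rmult_le_compat; try lra.
      rewrite <- (Rmult_1_l M) at 1. apply Rmult_le_compat_r; lra.
    + apply Rmult_le_compat_r; [pose proof (ex_ge1 t); lra|lra].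
  - replace (M * (/2)^(S n)) with (M * (/2)^n / 2) by (cbn [pow]; lra).
    apply (step_close (iterate (S n)) (iterate (S (S n))) (iterate n) (iterate (S n))); auto.
    apply Rmult_le_pos; [lra|apply pow_le; lra].
Qed.

(** The starting point [x0] may be unbounded over the lattice; only displacements from it are
    measured uniformly, which is why [F] is bounded at [x0] alone. The iterates converge
    geometrically at each time and site, so no complete function space is set up. *)
Lemma picard_lindelof : exists g : R -> Config d, g 0 = x0 /\
  (forall t i, derivable_pt_lim (fun s => g s i) t (F (g t) i)) /\
  (forall t i, Rabs (g t i - x0 i) <= 2 * M * exp (2 * K * Rabs t)).
Proof.
  pose (g := fun t i => epsilon (inhabits 0)
    (fun l => forall n, Rabs (l - iterate n t i) <= 2 * (M * ex t) * (/2)^n)).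
  assert (Hg : forall t i n, Rabs (g t i - iterate n t i) <= 2 * M * (/2)^n * ex t).
  { intros t i n. replace (2 * M * (/2)^n * ex t) with (2 * (M * ex t) * (/2)^n) by ring.
    revert n. unfold g. apply epsilon_spec. apply (geometric_limit (fun n => iterate n t i)).
    - pose proof (ex_M t 0); cbn in *; lra.
    - intros n. replace (M * ex t * (/2)^n) with (M * (/2)^n * ex t) by ring. apply iterate_close. }
  assert (small : forall a eps, 0 < eps -> exists n, a * (/2)^n <= eps).
  { intros a eps Heps. destruct (pow_lt_1_zero (/2)) with (y := eps / (Rabs a + 1)) as [N HN].
    - rewrite Rabs_pos_eq; lra.
    - apply Rdiv_lt_0_compat; [lra|pose proof (Rabs_pos a); lra].
    - exists N. specialize (HN N (le_n _)). rewrite Rabs_pos_eq in HN by (apply pow_le; lra).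
      pose proof (Rabs_pos a). pose proof (Rle_abs a).
      apply Rle_trans with ((Rabs a + 1) * (eps / (Rabs a + 1))); [|right; field; lra].
      apply Rmult_le_compat_r with (r := (/2)^N) in H0; [|apply pow_le; lra].
      eapply Rle_trans; [exact H0|]. apply Rmult_le_compat; try lra. apply pow_le; lra. }
  assert (good g) as Hgood.
  { split.
    - intros t eps Heps. destruct (small (2 * M * ex (Rabs t + 1)) (eps / 3)) as [n Hn]; [lra|].
      destruct (proj1 (iterate_good n) t (eps / 3)) as [delta [Hd H]]; [lra|].
      exists (Rmin 1 delta). split; [apply Rmin_glb_lt; lra|]. intros s Hs k.
      assert (Hs1 : Rabs (s - t) <= 1) by (pose proof (Rmin_l 1 delta); lra).
      assert (Hs2 : Rabs (s - t) < delta) by (pose proof (Rmin_r 1 delta); lra).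
      specialize (H s Hs2 k).
      assert (A : forall u, Rabs u <= Rabs t + 1 -> Rabs (g u k - iterate n u k) <= eps / 3).
      { intros u Hu. eapply Rle_trans; [apply Hg|].
        apply Rle_trans with (2 * M * (/2)^n * ex (Rabs t + 1)); [|lra].
        apply Rmult_le_compat_l; [|now apply ex_mono].
        apply Rmult_le_pos; [lra|apply pow_le; lra]. }
      assert (Rabs s <= Rabs t + 1).
      { replace s with (t + (s - t)) by lra. eapply Rle_trans; [apply Rabs_triang|lra]. }
      replace (g s k - g t k) with ((g s k - iterate n s k) + ((iterate n s k - iterate n t k)
        + - (g t k - iterate n t k))) by lra.
      eapply Rle_trans; [apply Rabs_triang|].
      pose proof (Rabs_triang (iterate n s k - iterate n t k) (- (g t k - iterate n t k))).
      rewrite Rabs_Ropp in *. pose proof (A s ltac:(lra)). pose proof (A t ltac:(lra)). lra.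
    - intros t i. specialize (Hg t i O). cbn in Hg. lra. }
  destruct (picard_step g Hgood) as [g' [Hgood' Hstep]].
  (* [g'] and [iterate (S n)] are the Picard images of [g] and [iterate n], so they are at most half
     as far apart; both sides tend to the same limit. *)
  assert (E : g' = g).
  { apply functional_extensionality; intros t. apply functional_extensionality; intros i.
    apply cond_eq. intros eps Heps.
    destruct (small (4 * M * ex t) (eps / 2)) as [n Hn]; [lra|].
    replace (g' t i - g t i) with ((g' t i - iterate (S n) t i) + - (g t i - iterate (S n) t i)) by lra.
    eapply Rle_lt_trans; [apply Rabs_triang|]. rewrite Rabs_Ropp.
    pose proof (Hg t i (S n)) as H1. cbn [pow] in H1. pose proof (ex_M t n).
    assert (Rabs (g' t i - iterate (S n) t i) <= 2 * M * (/2)^n / 2 * ex t).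
    { apply (step_close g g' (iterate n) (iterate (S n))); auto.
      repeat apply Rmult_le_pos; try lra. apply pow_le; lra. }
    lra. }
  subst g'. exists g. split; [apply Hstep|]. split; [apply Hstep|apply Hgood].
Qed.

End Picard.

(** * Flow lines *)

Definition wt {d} : Zd d -> R := geo (/2).

Lemma wt_pos {d} (i : Zd d) : 0 < wt i.
Proof. apply geo_pos; lra. Qed.

Lemma wt_le1 {d} (i : Zd d) : wt i <= 1.
Proof. unfold wt, geo. rewrite <- (pow1 (Z.to_nat (lnorm i))). apply pow_incr; lra. Qed.

Lemma wt_le_geo {d} (i : Zd d) : wt i <= geo (3/4) i.
Proof. unfold wt, geo. apply pow_incr; lra. Qed.

Lemma wsum_wt {d} L (x : Config d) : wsum L x = lsum (fun i => wt i * Rabs (x i)) L.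
Proof. reflexivity. Qed.

Lemma wsum_bound {d} L (x : Config d) b : NoDup L -> 0 <= b -> (forall i, Rabs (x i) <= b) ->
  wsum L x <= 7 ^ d * b.
Proof.
  intros HL Hb Hx. rewrite wsum_wt.
  apply Rle_trans with (lsum (fun i => b * geo (3/4) i) L).
  - apply lsum_le; intros i _. rewrite Rmult_comm.
    apply Rmult_le_compat; auto using Rabs_pos, wt_le_geo. left; apply wt_pos.
  - rewrite lsum_scal, Rmult_comm. apply Rmult_le_compat_r; auto using geo_summable.
Qed.

Lemma inX_bounded {d} (x : Config d) : inX x -> exists b, forall i, wt i * Rabs (x i) <= b.
Proof.
  intros [M HM]. exists M. intros i. specialize (HM (i :: nil)). cbn in HM. rewrite Rplus_0_r in HM.
  apply HM. repeat constructor; auto.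
Qed.

Lemma flow_line_coord {d} (S : Pot d) r g : flow_line S r g -> forall t eps, 0 < eps ->
  exists delta, 0 < delta /\ forall h, Rabs h < delta -> forall i,
    wt i * Rabs (g (t + h) i - g t i + h * gradW S r (g t) i) <= eps * Rabs h.
Proof.
  intros [_ Hg] t eps Heps. destruct (Hg t eps Heps) as [delta [Hd H]]. exists delta; split; [assumption|].
  intros h Hh i. destruct (Req_dec h 0) as [->|Hh0].
  - rewrite Rplus_0_r, Rmult_0_l, Rplus_0_r, Rminus_diag, Rabs_R0; lra.
  - specialize (H h Hh0 Hh (i :: nil)). cbn in H. rewrite Rplus_0_r in H. apply H. repeat constructor; auto.
Qed.

Lemma flow_line_derivable {d} (S : Pot d) r g : flow_line S r g -> forall t i,
  derivable_pt_lim (fun s => g s i) t (- gradW S r (g t) i).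
Proof.
  intros Hg t i eps Heps. pose proof (wt_pos i) as Hw.
  destruct (flow_line_coord S r g Hg t (eps / 2 * wt i)) as [delta [Hd H]].
  { apply Rmult_lt_0_compat; lra. }
  exists (mkposreal delta Hd). intros h Hh0 Hh. specialize (H h Hh i).
  assert (Hh' : 0 < Rabs h) by now apply Rabs_pos_lt.
  replace ((g (t + h) i - g t i) / h - - gradW S r (g t) i) with
    ((g (t + h) i - g t i + h * gradW S r (g t) i) / h) by now field.
  unfold Rdiv. rewrite Rabs_mult, Rabs_inv.
  assert (Rabs (g (t + h) i - g t i + h * gradW S r (g t) i) <= eps / 2 * Rabs h).
  { apply (Rmult_le_reg_l (wt i)); [assumption|lra]. }
  apply Rle_lt_trans with (eps / 2 * Rabs h * / Rabs h).
  - apply Rmult_le_compat_r; [left; now apply Rinv_0_lt_compat|assumption].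
  - rewrite Rmult_assoc, Rinv_r by lra. lra.
Qed.

Lemma flow_line_shift {d} (S : Pot d) r g t0 : flow_line S r g -> flow_line S r (fun t => g (t0 + t)).
Proof.
  intros [HX Hg]. split; [intros t; apply HX|]. intros t eps Heps.
  destruct (Hg (t0 + t) eps Heps) as [delta [Hd H]]. exists delta; split; [assumption|].
  intros h Hh0 Hh L HL. specialize (H h Hh0 Hh L HL). now rewrite Rplus_assoc in H.
Qed.

(** The field at [i] sees only sites at distance at most [n] from [i], and over that distance the
    weight changes by a factor of at most [2 ^ n]. *)
Lemma gradW_weighted_lipschitz {d} (S : Pot d) r : local_potentials S r ->
  exists Lam, 0 <= Lam /\ forall x y b, (forall k, wt k * Rabs (y k - x k) <= b) ->
    forall i, wt i * Rabs (gradW S r y i - gradW S r x i) <= Lam * b.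
Proof.
  intros HS. destruct (gradW_lipschitz S r HS) as [K [HK H]]. set (n := (2 * radius r)%nat) in *.
  exists (K * 2 ^ n). split; [apply Rmult_le_pos; [lra|apply pow_le; lra]|].
  intros x y b Hb i. pose proof (wt_pos i) as Hw.
  assert (Hb0 : 0 <= b).
  { eapply Rle_trans; [|apply (Hb i)]. apply Rmult_le_pos; [lra|apply Rabs_pos]. }
  assert (Hi : wt i * 2 ^ Z.to_nat (lnorm i) = 1).
  { unfold wt, geo. rewrite <- Rpow_mult_distr. replace (/2 * 2) with 1 by lra. apply pow1. }
  apply Rle_trans with (wt i * (K * (b * (2 ^ Z.to_nat (lnorm i) * 2 ^ n)))).
  - apply Rmult_le_compat_l; [lra|]. apply H. intros k Hk.
    assert (Hk' : wt k * 2 ^ Z.to_nat (lnorm k) = 1).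
    { unfold wt, geo. rewrite <- Rpow_mult_distr. replace (/2 * 2) with 1 by lra. apply pow1. }
    apply Rle_trans with (b * 2 ^ Z.to_nat (lnorm k)).
    + apply (Rmult_le_reg_l (wt k)); [apply wt_pos|]. rewrite (Rmult_comm b), <- Rmult_assoc, Hk', Rmult_1_l.
      apply Hb.
    + apply Rmult_le_compat_l; [assumption|]. rewrite <- pow_add. apply Rle_pow; [lra|].
      pose proof (lnorm_le_zsub k i). pose proof (lnorm_nonneg k). pose proof (lnorm_nonneg i). lia.
  - right. transitivity (wt i * 2 ^ Z.to_nat (lnorm i) * (K * 2 ^ n * b)); [ring|]. rewrite Hi; ring.
Qed.

Lemma wt_lub {d} (u : Config d) : (exists b, forall i, wt i * Rabs (u i) <= b) ->
  exists s, (forall i, wt i * Rabs (u i) <= s) /\ forall b, (forall i, wt i * Rabs (u i) <= b) -> s <= b.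
Proof.
  intros [b Hb]. destruct (completeness (fun v => exists i : Zd d, v = wt i * Rabs (u i))) as [s [Hub Hlub]].
  - exists b; intros v [i ->]; apply Hb.
  - exists (wt (@zero d) * Rabs (u zero)), zero; reflexivity.
  - exists s; split; [intros i; apply Hub; now exists i|]. intros c Hc; apply Hlub; intros v [i ->]; apply Hc.
Qed.

(** Gronwall for [phi t], the supremum over sites of the weighted difference at time [t]; the
    increments of the supremum are controlled because [flow_line_coord] is uniform in the site.
    [Lam] depends on [S] alone, so one constant serves all approximating [S']. *)
Lemma flow_line_compare {d} (S : Pot d) r : local_potentials S r ->
  exists Lam, 0 <= Lam /\ forall S' g h b c K, flow_line S' r g -> flow_line S r h ->
    (forall x i, Rabs (gradW S' r x i - gradW S r x i) <= c) -> 0 <= c < K ->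
    (forall i, wt i * Rabs (g 0 i - h 0 i) <= b) -> b < K ->
    forall t i, wt i * Rabs (g t i - h t i) <= K * exp ((Lam + 1) * Rabs t).
Proof.
  intros HS. destruct (gradW_weighted_lipschitz S r HS) as [Lam [HL Hlip]].
  exists Lam; split; [assumption|]. intros S' g h b c K Hg Hh Hc HcK Hb HbK.
  pose (phi := fun t => epsilon (inhabits 0) (fun s => (forall i, wt i * Rabs (g t i - h t i) <= s) /\
    forall b, (forall i, wt i * Rabs (g t i - h t i) <= b) -> s <= b)).
  assert (Hphi : forall t, (forall i, wt i * Rabs (g t i - h t i) <= phi t) /\
    forall b, (forall i, wt i * Rabs (g t i - h t i) <= b) -> phi t <= b).
  { intros t. unfold phi. apply epsilon_spec. apply (wt_lub (fun i => g t i - h t i)).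
    destruct (inX_bounded _ (proj1 Hg t)) as [b1 H1]. destruct (inX_bounded _ (proj1 Hh t)) as [b2 H2].
    exists (b1 + b2). intros i. specialize (H1 i). specialize (H2 i).
    pose proof (Rabs_triang (g t i) (- h t i)) as Ht. rewrite Rabs_Ropp in Ht.
    pose proof (wt_pos i).
    apply Rmult_le_compat_l with (r := wt i) in Ht; [|lra]. unfold Rminus. lra. }
  intros t i. left. eapply Rle_lt_trans; [apply (proj1 (Hphi t))|].
  apply (gronwall phi Lam c K); auto.
  { eapply Rle_lt_trans; [apply (proj2 (Hphi 0)); exact Hb|assumption]. }
  clear t i. intros t eps Heps.
  destruct (flow_line_coord S' r g Hg t (eps / 2)) as [d1 [Hd1 H1]]; [lra|].
  destruct (flow_line_coord S r h Hh t (eps / 2)) as [d2 [Hd2 H2]]; [lra|].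
  exists (Rmin d1 d2). split; [now apply Rmin_glb_lt|]. intros e He.
  assert (Hb' : forall i, Rabs (wt i * (g (t + e) i - h (t + e) i) - wt i * (g t i - h t i))
     <= Rabs e * (Lam * phi t + c + eps)).
  { intros i. specialize (H1 e ltac:(pose proof (Rmin_l d1 d2); lra) i).
    specialize (H2 e ltac:(pose proof (Rmin_r d1 d2); lra) i). pose proof (wt_pos i) as Hw.
    set (A := g (t + e) i - g t i + e * gradW S' r (g t) i) in *.
    set (B := h (t + e) i - h t i + e * gradW S r (h t) i) in *.
    replace (wt i * (g (t + e) i - h (t + e) i) - wt i * (g t i - h t i)) with
      (wt i * A + (- (wt i * B) + - (e * (wt i * (gradW S' r (g t) i - gradW S r (g t) i))
        + e * (wt i * (gradW S r (g t) i - gradW S r (h t) i))))) by (unfold A, B; ring).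
    eapply Rle_trans; [apply Rabs_triang|].
    eapply Rle_trans; [apply Rplus_le_compat_l, Rabs_triang|]. rewrite !Rabs_Ropp.
    eapply Rle_trans; [apply Rplus_le_compat_l, Rplus_le_compat_l, Rabs_triang|].
    rewrite !Rabs_mult, (Rabs_pos_eq (wt i)) by lra.
    assert (Rabs e * (wt i * Rabs (gradW S' r (g t) i - gradW S r (g t) i)) <= Rabs e * c).
    { apply Rmult_le_compat_l; [apply Rabs_pos|]. rewrite <- (Rmult_1_l c).
      apply Rmult_le_compat; auto using Rabs_pos, wt_le1. lra. }
    assert (Rabs e * (wt i * Rabs (gradW S r (g t) i - gradW S r (h t) i)) <= Rabs e * (Lam * phi t)).
    { apply Rmult_le_compat_l; [apply Rabs_pos|]. apply Hlip. apply Hphi. }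
    lra. }
  assert (Habs : forall u (i : Zd d), wt i * Rabs u = Rabs (wt i * u)).
  { intros u i. rewrite Rabs_mult, (Rabs_pos_eq (wt i)); [reflexivity|left; apply wt_pos]. }
  assert (phi (t + e) <= phi t + Rabs e * (Lam * phi t + c + eps)).
  { apply (proj2 (Hphi (t + e))). intros i. specialize (Hb' i). pose proof (proj1 (Hphi t) i) as Ht.
    rewrite Habs in *.
    pose proof (Rabs_triang_inv (wt i * (g (t + e) i - h (t + e) i)) (wt i * (g t i - h t i))). lra. }
  assert (phi t <= phi (t + e) + Rabs e * (Lam * phi t + c + eps)).
  { apply (proj2 (Hphi t)). intros i. specialize (Hb' i). pose proof (proj1 (Hphi (t + e)) i) as Ht.
    rewrite Habs in *. rewrite Rabs_minus_sym in Hb'.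
    pose proof (Rabs_triang_inv (wt i * (g t i - h t i)) (wt i * (g (t + e) i - h (t + e) i))). lra. }
  apply Rabs_le; lra.
Qed.

Lemma flow_line_unique {d} (S : Pot d) r g h t0 : local_potentials S r ->
  flow_line S r g -> flow_line S r h -> g t0 = h t0 -> forall t, g t = h t.
Proof.
  intros HS Hg Hh H0 t. destruct (flow_line_compare S r HS) as [Lam [HL H]].
  apply functional_extensionality; intros i. apply cond_eq. intros eps Heps.
  assert (HE : 0 < exp ((Lam + 1) * Rabs (t - t0))) by apply exp_pos.
  (* Equal fields and equal data allow [c = b = 0], so [K] can be any positive number; this choice
     makes the bound at time [t] half of [eps * wt i]. *)
  set (K := eps * wt i / 2 / exp ((Lam + 1) * Rabs (t - t0))).
  assert (HK : 0 < K).
  { unfold K. apply Rdiv_lt_0_compat; [|assumption]. pose proof (Rmult_lt_0_compat eps (wt i) Heps (wt_pos i)). lra. }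
  pose proof (H S (fun t => g (t0 + t)) (fun t => h (t0 + t)) 0 0 K
    (flow_line_shift S r g t0 Hg) (flow_line_shift S r h t0 Hh)) as P.
  cbn beta in P. rewrite Rplus_0_r, H0 in P.
  assert (P1 : wt i * Rabs (g (t0 + (t - t0)) i - h (t0 + (t - t0)) i) <= K * exp ((Lam + 1) * Rabs (t - t0))).
  { apply P; [|lra| |assumption]; intros; rewrite Rminus_diag, Rabs_R0; lra. }
  replace (t0 + (t - t0)) with t in P1 by lra.
  apply (Rmult_lt_reg_l (wt i)); [apply wt_pos|]. eapply Rle_lt_trans; [exact P1|].
  unfold K. unfold Rdiv. rewrite Rmult_assoc, Rinv_l by lra.
  pose proof (Rmult_lt_0_compat eps (wt i) Heps (wt_pos i)). lra.
Qed.

(** Picard gives derivatives site by site, whereas [flow_line] asks for the derivative in the norm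
    of X. By the mean value theorem the remainder is at most [K * B1 * |h|^2] at every site, and the
    summable weights turn this into a norm estimate. *)
Lemma flow_line_exists {d} (S : Pot d) r x W : local_potentials S r -> inX x -> 0 <= W ->
  (forall j m, Rabs (x (zadd j m) - x j) <= 1 + W * IZR (lnorm m)) ->
  exists g, flow_line S r g /\ g 0 = x.
Proof.
  intros HS HX HW Hx. destruct (gradW_bounded S r HS x W HW Hx) as [M [HM HMx]].
  destruct (gradW_lipschitz S r HS) as [K [HK Hlip]].
  set (F := fun (x : Config d) i => - gradW S r x i).
  assert (F_lip : forall x y b, (forall k, Rabs (y k - x k) <= b) -> forall i, Rabs (F y i - F x i) <= K * b).
  { intros y z b Hb i. unfold F. replace (- gradW S r z i - - gradW S r y i) with
      (- (gradW S r z i - gradW S r y i)) by lra. rewrite Rabs_Ropp. apply Hlip. intros k _; apply Hb. }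
  assert (F_bdd : forall i, Rabs (F x i) <= M) by (intros i; unfold F; rewrite Rabs_Ropp; apply HMx).
  destruct (picard_lindelof F x K M HK HM F_lip F_bdd) as [g [H0 [Hd Hb]]].
  exists g. split; [|assumption].
  assert (Hex : forall t, 0 <= 2 * M * exp (2 * K * t)).
  { intros t. repeat apply Rmult_le_pos; try lra. left; apply exp_pos. }
  split.
  - intros t. destruct HX as [B HB]. exists (B + 7 ^ d * (2 * M * exp (2 * K * Rabs t))).
    intros L HL. specialize (HB L HL).
    assert (H1 : wsum L (fun i => g t i - x i) <= 7 ^ d * (2 * M * exp (2 * K * Rabs t))).
    { apply wsum_bound; auto. }
    apply Rle_trans with (wsum L x + wsum L (fun i => g t i - x i)); [|lra].
    rewrite !wsum_wt, <- lsum_plus. apply lsum_le; intros i _. pose proof (wt_pos i).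
    rewrite <- Rmult_plus_distr_l. apply Rmult_le_compat_l; [lra|].
    replace (g t i) with (x i + (g t i - x i)) at 1 by lra. apply Rabs_triang.
  - intros t eps Heps. set (B := 2 * M * exp (2 * K * (Rabs t + 1))). set (B1 := M + K * B).
    assert (HB0 : 0 <= B) by apply Hex.
    assert (HB1 : 0 <= B1).
    { unfold B1. apply Rplus_le_le_0_compat; [assumption|]. apply Rmult_le_pos; [lra|assumption]. }
    assert (HF : forall c, Rabs c <= Rabs t + 1 -> forall i, Rabs (F (g c) i) <= B1).
    { intros c Hc i. replace (F (g c) i) with (F x i + (F (g c) i - F x i)) by lra.
      eapply Rle_trans; [apply Rabs_triang|]. unfold B1. apply Rplus_le_compat; [apply F_bdd|].
      apply F_lip. intros k. eapply Rle_trans; [apply Hb|]. unfold B. apply Rmult_le_compat_l; [lra|].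
      destruct Hc as [Hc| ->]; [|right; reflexivity]. left; apply exp_increasing.
      apply Rmult_lt_compat_l; lra. }
    assert (Hmv : forall h i, Rabs h <= 1 -> exists c, Rabs (c - t) <= Rabs h /\ Rabs c <= Rabs t + 1 /\
        g (t + h) i - g t i = F (g c) i * h).
    { intros h i Hh. destruct (mean_value (fun s => g s i) (fun s => F (g s) i) t (t + h)) as [c [Hc He]];
        [intros; apply Hd|]. exists c. replace (t + h - t) with h in He by lra.
      assert (Hct : Rabs (c - t) <= Rabs h).
      { unfold Rmin, Rmax in Hc. unfold Rabs. destruct Rle_dec; repeat destruct Rcase_abs; lra. }
      split; [assumption|]. split; [|assumption].
      replace c with (t + (c - t)) by lra. eapply Rle_trans; [apply Rabs_triang|lra]. }
    set (D := 7 ^ d * (K * B1)).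
    assert (HD : 0 <= D).
    { unfold D. apply Rmult_le_pos; [apply pow_le; lra|]. apply Rmult_le_pos; lra. }
    exists (Rmin 1 (eps / (D + 1))). split.
    { apply Rmin_glb_lt; [lra|]. apply Rdiv_lt_0_compat; lra. }
    intros h _ Hh L HL.
    assert (Hh1 : Rabs h <= 1) by (pose proof (Rmin_l 1 (eps / (D + 1))); lra).
    assert (Hh2 : Rabs h <= eps / (D + 1)) by (pose proof (Rmin_r 1 (eps / (D + 1))); lra).
    pose proof (Rabs_pos h) as Hh0.
    apply Rle_trans with (7 ^ d * (K * (B1 * Rabs h) * Rabs h)).
    + apply wsum_bound; [assumption| |].
      { repeat apply Rmult_le_pos; lra. }
      intros i. destruct (Hmv h i Hh1) as [c [Hct [Hc He]]].
      replace (g (t + h) i - g t i + h * gradW S r (g t) i) with ((F (g c) i - F (g t) i) * h)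
        by (rewrite He; unfold F; ring).
      rewrite Rabs_mult. apply Rmult_le_compat_r; [assumption|]. apply F_lip. intros k.
      destruct (Hmv (c - t) k ltac:(lra)) as [c' [_ [Hc' He']]].
      replace (t + (c - t)) with c in He' by lra. rewrite He', Rabs_mult.
      apply Rmult_le_compat; auto using Rabs_pos.
    + replace (7 ^ d * (K * (B1 * Rabs h) * Rabs h)) with (D * Rabs h * Rabs h) by (unfold D; ring).
      apply Rmult_le_compat_r; [assumption|].
      apply Rle_trans with ((D + 1) * (eps / (D + 1))); [|right; field; lra].
      apply Rmult_le_compat; lra.
Qed.

(* Backward strong maximum principle: a first contact propagates to all neighbours at earlier times. *)
Lemma flow_line_strong_comparison {d} (S : Pot d) r g h : local_potentials S r ->
  flow_line S r g -> flow_line S r h -> (forall t i, g t i <= h t i) ->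
  sll (g 0) (h 0) \/ g 0 = h 0.
Proof.
  intros HS Hg Hh Hle.
  destruct (classic (exists i, g 0 i = h 0 i)) as [[i0 Hi0]|Hn].
  2: { left; intros i. destruct (Hle 0 i) as [|E]; [assumption|]. contradiction Hn; eauto. }
  right. destruct (gradW_antitone S r HS) as [A [HA Hanti]].
  pose proof (flow_line_derivable S r g Hg) as Dg. pose proof (flow_line_derivable S r h Hh) as Dh.
  (* The integrating factor [exp (A * s)] makes the nonnegative difference nondecreasing; as it
     vanishes at time 0, it vanishes before. *)
  assert (Hpast : forall i, g 0 i = h 0 i -> forall t, t <= 0 -> g t i = h t i).
  { intros i Hi t Ht.
    destruct (mean_value (fun s => exp (A * s) * (h s i - g s i))
      (fun s => exp (A * s) * A * (h s i - g s i)
        + exp (A * s) * (- gradW S r (h s) i - - gradW S r (g s) i)) t 0) as [c [_ Hc]].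
    - intros s. apply (derivable_pt_lim_mult (fun s => exp (A * s)) (fun s => h s i - g s i)).
      + apply (derivable_pt_lim_comp (fun s => A * s) exp); [|apply derivable_pt_lim_exp].
        pose proof (derivable_pt_lim_scal id A s 1 (derivable_pt_lim_id s)) as D.
        rewrite Rmult_1_r in D; exact D.
      + now apply derivable_pt_lim_minus.
    - rewrite Hi, Rminus_diag, Rmult_0_r in Hc. specialize (Hanti i (g c) (h c) (Hle c)).
      assert (0 <= (exp (A * c) * A * (h c i - g c i)
        + exp (A * c) * (- gradW S r (h c) i - - gradW S r (g c) i)) * (0 - t)).
      { apply Rmult_le_pos; [|lra]. rewrite Rmult_assoc, <- Rmult_plus_distr_l.
        apply Rmult_le_pos; [left; apply exp_pos|lra]. }
      pose proof (Hle t i). assert (0 <= exp (A * t) * (h t i - g t i)).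
      { apply Rmult_le_pos; [left; apply exp_pos|lra]. }
      assert (E : exp (A * t) * (h t i - g t i) = 0) by lra.
      apply Rmult_integral in E. pose proof (exp_pos (A * t)). destruct E; lra. }
  apply functional_extensionality.
  apply (lattice_connected (fun i => g 0 i = h 0 i) i0 Hi0). intros i k Hik Hi.
  (* Strictly negative [t] leaves a two-sided time interval on which the [i]-th coordinates agree,
     so their derivatives, hence the fields at [i], agree at [t]. *)
  assert (Hk : forall t, t < 0 -> g t k = h t k).
  { intros t Ht. apply (gradW_strict S r HS i k (g t) (h t)); auto; [apply Hpast; auto; lra|].
    apply Ropp_eq_reg. apply (uniqueness_limite (fun s => g s i) t); [apply Dg|].
    intros eps Heps. destruct (Dh t i eps Heps) as [delta H].
    assert (Hd : 0 < Rmin delta (- t)) by (apply Rmin_glb_lt; [apply cond_pos|lra]).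
    exists (mkposreal _ Hd). cbn. intros e He0 He.
    rewrite (Hpast i Hi t), (Hpast i Hi (t + e)) by
      (pose proof (Rle_abs e); pose proof (Rmin_r delta (- t)); lra).
    apply H; [assumption|]. pose proof (Rmin_l delta (- t)); lra. }
  (* Time 0 itself is reached by continuity from the past. *)
  apply cond_eq. intros eps Heps.
  destruct (derivable_continuous_pt (fun s => h s k - g s k) 0
    (exist _ _ (derivable_pt_lim_minus _ _ _ _ _ (Dh 0 k) (Dg 0 k))) eps Heps) as [delta [Hd H]].
  specialize (H (- (delta / 2))). cbn in H. unfold Rdist in H.
  rewrite (Hk (- (delta / 2))) in H by lra.
  replace (h (- (delta / 2)) k - h (- (delta / 2)) k - (h 0 k - g 0 k)) with (g 0 k - h 0 k) in H by lra.
  apply H. split; [split; [exact I|lra]|].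
  replace (- (delta / 2) - 0) with (- (delta / 2)) by lra. rewrite Rabs_Ropp, Rabs_pos_eq; lra.
Qed.

(** * Sequences and extractions *)

Definition extraction (phi : nat -> nat) : Prop := forall m, (phi m < phi (S m))%nat.

Lemma extraction_lt phi m n : extraction phi -> (m < n)%nat -> (phi m < phi n)%nat.
Proof. intros H Hmn; induction Hmn; [apply H|]. specialize (H m0); lia. Qed.

Lemma extraction_ge phi m : extraction phi -> (m <= phi m)%nat.
Proof. intros H; induction m; [lia|]. specialize (H m); lia. Qed.

Lemma extraction_comp phi psi : extraction phi -> extraction psi -> extraction (fun m => phi (psi m)).
Proof. intros H1 H2 m. apply extraction_lt; auto. Qed.

Lemma Un_cv_extraction u l phi : extraction phi -> Un_cv u l -> Un_cv (fun m => u (phi m)) l.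
Proof.
  intros Hphi Hu eps Heps. destruct (Hu eps Heps) as [N HN]. exists N. intros n Hn. apply HN.
  pose proof (extraction_ge phi n Hphi); lia.
Qed.

Lemma extraction_exists (P : nat -> nat -> Prop) : (forall m N, exists n, (N <= n)%nat /\ P m n) ->
  exists phi, extraction phi /\ forall m, P m (phi m).
Proof.
  intros H. pose (pick := fun m N => epsilon (inhabits O) (fun n => (N <= n)%nat /\ P m n)).
  assert (Hpick : forall m N, (N <= pick m N)%nat /\ P m (pick m N)).
  { intros m N. apply epsilon_spec, H. }
  pose (phi := fix phi m := match m with O => pick O O | S k => pick (S k) (S (phi k)) end).
  exists phi. split.
  - intros m. apply (proj1 (Hpick (S m) (S (phi m)))).
  - intros [|m]; apply Hpick.
Qed.

Lemma inv_INR_S_lt eps : 0 < eps -> exists N, forall n, (N <= n)%nat -> / INR (S n) < eps.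
Proof.
  intros Heps. destruct (archimed_cor1 eps Heps) as [N [HN HN0]]. exists N. intros n Hn.
  eapply Rle_lt_trans; [|exact HN]. apply Rinv_le_contravar; [now apply lt_0_INR|]. apply le_INR; lia.
Qed.

Lemma bounded_subsequence u M : (forall n, Rabs (u n) <= M) ->
  exists phi l, extraction phi /\ Un_cv (fun m => u (phi m)) l.
Proof.
  intros Hu. destruct (Bolzano_Weierstrass u (fun c => - M <= c <= M) (compact_P3 _ _)) as [l Hl].
  { intros n. now apply Coquelicot.Rcomplements.Rabs_le_between. }
  destruct (extraction_exists (fun m n => Rabs (u n - l) < / INR (S m))) as [phi [Hphi H]].
  { intros m N. assert (Hm : 0 < / INR (S m)) by (apply Rinv_0_lt_compat, lt_0_INR; lia).
    destruct (Hl (disc l (mkposreal _ Hm)) N) as [p [Hp1 Hp2]]; [|now exists p].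
    exists (mkposreal _ Hm). intros x Hx; exact Hx. }
  exists phi, l. split; [assumption|]. intros eps Heps. destruct (inv_INR_S_lt eps Heps) as [N HN].
  exists N. intros n Hn. unfold Rdist. specialize (H n). specialize (HN n Hn). lra.
Qed.

Lemma diagonal_extraction (f : nat -> nat -> R) : (forall k, exists M, forall n, Rabs (f k n) <= M) ->
  exists phi, extraction phi /\ forall k, exists l, Un_cv (fun m => f k (phi m)) l.
Proof.
  intros Hf.
  pose (sub := fun u : nat -> R => epsilon (inhabits (fun n : nat => n))
    (fun phi => extraction phi /\ exists l, Un_cv (fun m => u (phi m)) l)).
  assert (Hsub : forall u, (exists M, forall n, Rabs (u n) <= M) ->
     extraction (sub u) /\ exists l, Un_cv (fun m => u (sub u m)) l).
  { intros u [M HM]. unfold sub. apply epsilon_spec. destruct (bounded_subsequence u M HM) as [phi [l [H1 H2]]].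
    exists phi; eauto. }
  pose (sg := fix sg k : nat -> nat := match k with
    | O => fun m => m
    | S k => fun m => sg k (sub (fun n => f k (sg k n)) m) end).
  assert (Hb : forall k, extraction (sub (fun n => f k (sg k n))) /\
     exists l, Un_cv (fun m => f k (sg (S k) m)) l).
  { intros k. apply (Hsub (fun n => f k (sg k n))). destruct (Hf k) as [M HM]. exists M; intros n; apply HM. }
  assert (Hsg : forall k, extraction (sg k)).
  { induction k; [intros m; cbn; lia|]. cbn. apply extraction_comp; [assumption|apply Hb]. }
  (* Each entry of a deeper extraction occurs in the extraction of level [k] at an index at least as
     large, so the diagonal eventually runs inside every level. *)
  assert (Htail : forall k p m, exists q, (m <= q)%nat /\ sg (k + p)%nat m = sg k q).
  { intros k. induction p; intros m; [exists m; rewrite Nat.add_0_r; auto|].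
    rewrite Nat.add_succ_r. cbn.
    destruct (IHp (sub (fun n => f (k + p)%nat (sg (k + p)%nat n)) m)) as [q [Hq ->]].
    exists q; split; [|reflexivity].
    pose proof (extraction_ge _ m (proj1 (Hb (k + p)%nat))); lia. }
  exists (fun m => sg m m). split.
  - intros m. cbn. apply extraction_lt; [apply Hsg|].
    pose proof (extraction_ge _ (S m) (proj1 (Hb m))); lia.
  - intros k. destruct (proj2 (Hb k)) as [l Hl]. exists l. intros eps Heps.
    (* The sequence [f k] converges along level [S k], the one extracted for its sake, so the
       diagonal is read from index [S k] on. *)
    destruct (Hl eps Heps) as [N HN]. exists (Nat.max N (S k)). intros n Hn.
    destruct (Htail (S k) (n - S k)%nat n) as [q [Hq E]].
    replace (S k + (n - S k))%nat with n in E by lia. rewrite E. apply HN; lia.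
Qed.

Lemma Zd_countable d : exists e : nat -> Zd d, forall i, exists n, e n = i.
Proof.
  induction d as [|d [e He]].
  - exists (fun _ => Vector.nil Z). intros i. exists O. symmetry.
    apply (Vector.case0 (fun v => v = Vector.nil Z)). reflexivity.
  - exists (fun n => let (a, b) := Cantor.of_nat n in let (p, q) := Cantor.of_nat a in
      Vector.cons Z (Z.of_nat p - Z.of_nat q)%Z d (e b)).
    intros i. rewrite (Vector.eta i). destruct (He (Vector.tl i)) as [b Hb]. set (a := Vector.hd i).
    exists (Cantor.to_nat (Cantor.to_nat (Z.to_nat a, Z.to_nat (- a)), b)).
    rewrite !Cantor.cancel_of_to, Hb. f_equal. lia.
Qed.

Definition pw_cv {d} (a : nat -> Config d) (x : Config d) : Prop := forall i, Un_cv (fun n => a n i) (x i).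

Lemma config_diagonal {d} (a : nat -> nat -> Config d) :
  (forall q i, exists M, forall n, Rabs (a q n i) <= M) ->
  exists phi, extraction phi /\ forall q, exists x, pw_cv (fun m => a q (phi m)) x.
Proof.
  intros Ha. destruct (Zd_countable d) as [e He].
  destruct (diagonal_extraction (fun k n => let (q, b) := Cantor.of_nat k in a q n (e b))) as [phi [Hphi H]].
  { intros k. destruct (Cantor.of_nat k) as [q b]. apply Ha. }
  exists phi; split; [assumption|]. intros q.
  exists (fun i => epsilon (inhabits 0) (fun l => Un_cv (fun m => a q (phi m) i) l)).
  intros i. apply epsilon_spec. destruct (He i) as [b <-].
  destruct (H (Cantor.to_nat (q, b))) as [l Hl]. exists l. now rewrite Cantor.cancel_of_to in Hl.
Qed.

Lemma config_compact {d} (a : nat -> Config d) : (forall i, exists M, forall n, Rabs (a n i) <= M) ->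
  exists phi x, extraction phi /\ pw_cv (fun m => a (phi m)) x.
Proof.
  intros Ha. destruct (config_diagonal (fun _ => a)) as [phi [Hphi H]]; [auto|].
  destruct (H O) as [x Hx]. eauto.
Qed.

Lemma Un_cv_const c : Un_cv (fun _ => c) c.
Proof. intros eps Heps; exists O; intros; unfold Rdist; now rewrite Rminus_diag, Rabs_R0. Qed.

Lemma Un_cv_frequently_le u v a b : Un_cv u a -> Un_cv v b ->
  (forall N, exists n, (N <= n)%nat /\ u n <= v n) -> a <= b.
Proof.
  intros Hu Hv H. apply Rnot_lt_le; intros Hlt.
  destruct (Hu ((a - b) / 2)) as [N1 H1]; [lra|]. destruct (Hv ((a - b) / 2)) as [N2 H2]; [lra|].
  destruct (H (Nat.max N1 N2)) as [n [Hn Huv]].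
  specialize (H1 n ltac:(lia)). specialize (H2 n ltac:(lia)). unfold Rdist in *.
  apply Rabs_def2 in H1, H2. lra.
Qed.

Lemma Un_cv_le_compat u v a b : Un_cv u a -> Un_cv v b -> (forall n, u n <= v n) -> a <= b.
Proof. intros Hu Hv H. apply (Un_cv_frequently_le u v); auto. intros N; exists N; auto. Qed.

Lemma Un_cv_ext u v l : (forall n, u n = v n) -> Un_cv u l -> Un_cv v l.
Proof. intros H Hu eps Heps. destruct (Hu eps Heps) as [N HN]. exists N. intros n Hn. rewrite <- H. auto. Qed.

Lemma Un_cv_abs_le u l M : Un_cv u l -> (forall n, Rabs (u n) <= M) -> Rabs l <= M.
Proof.
  intros Hu H. apply (Un_cv_le_compat (fun n => Rabs (u n)) (fun _ => M)); auto; [|apply Un_cv_const].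
  now apply cv_cvabs.
Qed.

Lemma Un_cv_bounded u l : Un_cv u l -> exists M, forall n, Rabs (u n) <= M.
Proof.
  intros Hu. destruct (maj_by_pos u (exist _ l Hu)) as [M [_ HM]]. exists M; exact HM.
Qed.

(** * A single ghost circle *)

Definition l1norm {d} (w : Rd d) : R := Vector.fold_right (fun a s => Rabs a + s) w 0.

Lemma l1norm_nonneg {d} (w : Rd d) : 0 <= l1norm w.
Proof. induction w as [|a d w IH]; cbn; [lra|]. pose proof (Rabs_pos a). unfold l1norm in IH. lra. Qed.

Lemma ip_cons {d} a (w : Rd d) b (i : Zd d) : ip (Vector.cons R a d w) (Vector.cons Z b d i) = a * IZR b + ip w i.
Proof. reflexivity. Qed.

Lemma ip_abs_le {d} (w : Rd d) (i : Zd d) : Rabs (ip w i) <= l1norm w * IZR (lnorm i).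
Proof.
  refine (Vector.rect2 (fun d w i => Rabs (@ip d w i) <= l1norm w * IZR (lnorm i)) _ _ w i).
  - cbn. rewrite Rabs_R0; lra.
  - clear. intros d w i IH a b. rewrite ip_cons, lnorm_cons, plus_IZR, abs_IZR.
    change (l1norm (Vector.cons R a d w)) with (Rabs a + l1norm w).
    eapply Rle_trans; [apply Rabs_triang|]. rewrite Rabs_mult.
    pose proof (l1norm_nonneg w). pose proof (IZR_le _ _ (lnorm_nonneg i)).
    pose proof (Rmult_le_pos _ _ (Rabs_pos a) H0). pose proof (Rmult_le_pos _ _ H (Rabs_pos (IZR b))). lra.
Qed.

Lemma ip_zscale {d} (w : Rd d) n (i : Zd d) : ip w (zscale n i) = IZR n * ip w i.
Proof.
  refine (Vector.rect2 (fun d w i => @ip d w (zscale n i) = IZR n * ip w i) _ _ w i).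
  - cbn. lra.
  - clear. intros d w i IH a b.
    change (zscale n (Vector.cons Z b d i)) with (Vector.cons Z (n * b)%Z d (zscale n i)).
    rewrite !ip_cons, IH, mult_IZR. ring.
Qed.

Lemma Rd_cv_ip {d} (ws : nat -> Rd d) w : Rd_cv ws w ->
  (exists W, forall n, l1norm (ws n) <= W) /\ forall i, Un_cv (fun n => ip (ws n) i) (ip w i).
Proof.
  revert ws w. induction d as [|d IH]; intros ws w H.
  - assert (E : forall v : Rd 0, v = Vector.nil R) by (intros v; now apply (Vector.case0 (fun v => v = Vector.nil R))).
    split.
    + exists 0. intros n. rewrite (E (ws n)). cbn; lra.
    + intros i. apply (Un_cv_ext (fun _ => ip w i)); [|apply Un_cv_const]. intros n. now rewrite (E (ws n)), (E w).
  - destruct (IH (fun n => Vector.tl (ws n)) (Vector.tl w)) as [[W HW] Hip].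
    { intros k. specialize (H (Fin.FS k)). rewrite (Vector.eta w) in H. cbn in H.
      refine (Un_cv_ext _ _ _ _ H). intros n. now rewrite (Vector.eta (ws n)). }
    assert (Hhd : Un_cv (fun n => Vector.hd (ws n)) (Vector.hd w)).
    { specialize (H Fin.F1). rewrite (Vector.eta w) in H. cbn in H.
      refine (Un_cv_ext _ _ _ _ H). intros n. now rewrite (Vector.eta (ws n)). }
    split.
    + destruct (Un_cv_bounded _ _ Hhd) as [M HM]. exists (M + W). intros n. rewrite (Vector.eta (ws n)).
      change (Rabs (Vector.hd (ws n)) + l1norm (Vector.tl (ws n)) <= M + W). specialize (HM n). specialize (HW n).
      cbn beta in HW. lra.
    + intros i. rewrite (Vector.eta i), (Vector.eta w), ip_cons.
      apply (Un_cv_ext (fun n => Vector.hd (ws n) * IZR (Vector.hd i) + ip (Vector.tl (ws n)) (Vector.tl i))).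
      { intros n. now rewrite (Vector.eta (ws n)), ip_cons. }
      apply CV_plus; [|apply Hip]. apply (CV_mult _ (fun _ => IZR (Vector.hd i))); [exact Hhd|apply Un_cv_const].
Qed.

Lemma tau_zero_apply {d} (x : Config d) k l : tau k l x zero = x k + IZR l.
Proof. unfold tau; now rewrite zadd_zero_l. Qed.

Lemma tau_iterate_le {d} (x : Config d) i l : (forall k, x k <= tau i l x k) ->
  forall n, x zero <= x (zscale (Z.of_nat n) i) + INR n * IZR l.
Proof.
  intros H. induction n.
  - replace (zscale (Z.of_nat 0) i) with (@zero d) by zd. cbn; lra.
  - specialize (H (zscale (Z.of_nat n) i)). unfold tau in H.
    replace (zscale (Z.of_nat (S n)) i) with (zadd (zscale (Z.of_nat n) i) i) by zd.
    rewrite S_INR. lra.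
Qed.

Lemma tau_iterate_ge {d} (x : Config d) i l : (forall k, tau i l x k <= x k) ->
  forall n, x (zscale (Z.of_nat n) i) + INR n * IZR l <= x zero.
Proof.
  intros H. induction n.
  - replace (zscale (Z.of_nat 0) i) with (@zero d) by zd. cbn; lra.
  - specialize (H (zscale (Z.of_nat n) i)). unfold tau in H.
    replace (zscale (Z.of_nat (S n)) i) with (zadd (zscale (Z.of_nat n) i) i) by zd.
    rewrite S_INR. lra.
Qed.

Lemma Un_cv_div_INR c : Un_cv (fun n => c / INR n) 0.
Proof.
  replace 0 with (c * 0) by lra. unfold Rdiv. apply (CV_mult (fun _ => c)); [apply Un_cv_const|].
  intros eps Heps. destruct (inv_INR_S_lt eps Heps) as [N HN]. exists (S N). intros [|n] Hn; [lia|].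
  unfold Rdist. rewrite Rminus_0_r, Rabs_pos_eq; [apply HN; lia|].
  left; apply Rinv_0_lt_compat, lt_0_INR; lia.
Qed.

Section GhostCircle.
Context {d : nat} (S : Pot d) (r : R) (G : Config d -> Prop).
Hypothesis HG : ghost_circle S r G.

Lemma ghost_trichotomy x y : G x -> G y -> sll x y \/ x = y \/ sll y x.
Proof. apply HG. Qed.

Lemma ghost_tau k l x : G x -> G (tau k l x).
Proof. apply HG. Qed.

Lemma ghost_le x y i : G x -> G y -> x i <= y i -> forall k, x k <= y k.
Proof.
  intros Hx Hy Hi k. destruct (ghost_trichotomy x y Hx Hy) as [H|[->|H]]; [left; apply H|lra|].
  specialize (H i). lra.
Qed.

Lemma ghost_eq x y i : G x -> G y -> x i = y i -> x = y.
Proof.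
  intros Hx Hy Hi. destruct (ghost_trichotomy x y Hx Hy) as [H|[->|H]]; [|reflexivity|];
    specialize (H i); lra.
Qed.

(** Vertical integer translates reach below and above [xi]; if the value were omitted, the open
    half-spaces on either side would disconnect [G]. *)
Lemma ghost_param xi : exists x, G x /\ x zero = xi.
Proof.
  destruct HG as [[x0 Hx0] [_ [Hconn _]]]. apply NNPP. intros Hn. apply Hconn.
  assert (Hshift : forall l : Z, G (tau zero l x0)) by (intros; now apply ghost_tau).
  exists (fun x => x zero < xi), (fun x => xi < x zero). repeat split.
  - intros x Hx. exists (zero :: nil), (xi - x zero). split; [lra|]. intros y Hy.
    specialize (Hy zero (or_introl eq_refl)). apply Rabs_def2 in Hy. lra.
  - intros x Hx. exists (zero :: nil), (x zero - xi). split; [lra|]. intros y Hy.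
    specialize (Hy zero (or_introl eq_refl)). apply Rabs_def2 in Hy. lra.
  - intros x Hx. destruct (Rtotal_order (x zero) xi) as [|[E|]]; auto. contradiction Hn; eauto.
  - exists (tau zero (- up (x0 zero - xi)) x0). split; [apply Hshift|]. rewrite tau_zero_apply, opp_IZR.
    pose proof (archimed (x0 zero - xi)). lra.
  - exists (tau zero (up (xi - x0 zero)) x0). split; [apply Hshift|]. rewrite tau_zero_apply.
    pose proof (archimed (xi - x0 zero)). lra.
  - intros x _ H1 H2. lra.
Qed.

(** Strict order makes [x] comparable with [tau i l x]. Iterating the comparison [n] times and
    dividing by [n] transfers the sign of [x i + l - x zero] to [ip w i + l]. The bound depends
    neither on the circle nor on [w], so it survives the limit. *)
Lemma ghost_rot_bound w x i : ghost_rot G w -> G x -> Rabs (x i - x zero - ip w i) <= 1.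
Proof.
  intros Hw Hx. pose proof (Hw x Hx i) as Hrot.
  assert (Hcv : forall l, Un_cv (fun n => x (zscale (Z.of_nat n) i) / INR n + IZR l) (ip w i + IZR l)).
  { intros l. apply (CV_plus _ (fun _ => IZR l)); [exact Hrot|apply Un_cv_const]. }
  assert (A : forall l, x zero <= x i + IZR l -> 0 <= ip w i + IZR l).
  { intros l Hl. apply (Un_cv_frequently_le (fun n => x zero / INR n) _ _ _ (Un_cv_div_INR _) (Hcv l)).
    intros N. exists (Datatypes.S N). split; [lia|]. set (n := Datatypes.S N).
    assert (Hn : 0 < INR n) by (apply lt_0_INR; lia).
    replace (x (zscale (Z.of_nat n) i) / INR n + IZR l) with
      ((x (zscale (Z.of_nat n) i) + INR n * IZR l) / INR n) by (field; lra).
    apply Rmult_le_compat_r; [left; now apply Rinv_0_lt_compat|]. apply tau_iterate_le.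
    apply (ghost_le x (tau i l x) zero); auto using ghost_tau. now rewrite tau_zero_apply. }
  assert (B : forall l, x i + IZR l <= x zero -> ip w i + IZR l <= 0).
  { intros l Hl. apply (Un_cv_frequently_le _ (fun n => x zero / INR n) _ _ (Hcv l) (Un_cv_div_INR _)).
    intros N. exists (Datatypes.S N). split; [lia|]. set (n := Datatypes.S N).
    assert (Hn : 0 < INR n) by (apply lt_0_INR; lia).
    replace (x (zscale (Z.of_nat n) i) / INR n + IZR l) with
      ((x (zscale (Z.of_nat n) i) + INR n * IZR l) / INR n) by (field; lra).
    apply Rmult_le_compat_r; [left; now apply Rinv_0_lt_compat|]. apply tau_iterate_ge.
    apply (ghost_le (tau i l x) x zero); auto using ghost_tau. now rewrite tau_zero_apply. }
  (* Two consecutive integers [l] enclose both [x i - x zero] and [ip w i] in the same interval of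
     length one. *)
  pose proof (archimed (x zero - x i)) as [Hu1 Hu2].
  specialize (A (up (x zero - x i)) ltac:(lra)).
  specialize (B (up (x zero - x i) - 1)%Z). rewrite minus_IZR in B. specialize (B ltac:(lra)).
  apply Rabs_le. lra.
Qed.

Lemma ghost_rot_increment w x j m : ghost_rot G w -> G x -> Rabs (x (zadd j m) - x j - ip w m) <= 1.
Proof.
  intros Hw Hx. pose proof (ghost_rot_bound w (tau j 0 x) m Hw (ghost_tau j 0 x Hx)) as H.
  rewrite tau_zero_apply in H. unfold tau in H. rewrite !Rplus_0_r, zadd_comm in H. exact H.
Qed.

Lemma ghost_rot_growth w x j m : ghost_rot G w -> G x ->
  Rabs (x (zadd j m) - x j) <= 1 + l1norm w * IZR (lnorm m).
Proof.
  intros Hw Hx. pose proof (ghost_rot_increment w x j m Hw Hx). pose proof (ip_abs_le w m).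
  replace (x (zadd j m) - x j) with ((x (zadd j m) - x j - ip w m) + ip w m) by lra.
  eapply Rle_trans; [apply Rabs_triang|lra].
Qed.

Hypothesis HS : local_potentials S r.

(** Existence of a flow line comes from linear growth; only then does the invariance clause of
    [ghost_circle] apply and keep it inside [G]. *)
Lemma ghost_flow_line w x : ghost_rot G w -> G x ->
  exists g, flow_line S r g /\ g 0 = x /\ forall t, G (g t).
Proof.
  intros Hw Hx. destruct HG as [_ [_ [_ [_ [_ [_ [HX Hflow]]]]]]].
  destruct (flow_line_exists S r x (l1norm w) HS (HX x Hx) (l1norm_nonneg w)) as [g [Hg H0]].
  - intros j m; now apply ghost_rot_growth.
  - exists g. split; [assumption|]. split; [assumption|]. now apply (Hflow x).
Qed.

(** If the order were reversed at time [t], the zeroth coordinates would agree at some time [s] by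
    the intermediate value theorem. Strict order then gives [g s = h s], and uniqueness makes the
    two lines coincide at [t] as well. *)
Lemma ghost_flow_line_le x y g h : G x -> G y -> (forall i, x i <= y i) ->
  flow_line S r g -> g 0 = x -> flow_line S r h -> h 0 = y -> forall t i, g t i <= h t i.
Proof.
  intros Hx Hy Hxy Hg Hg0 Hh Hh0 t.
  assert (HGg : forall s, G (g s)) by (intros s; now apply HG with (x := x)).
  assert (HGh : forall s, G (h s)) by (intros s; now apply HG with (x := y)).
  apply (ghost_le (g t) (h t) zero); auto. apply Rnot_lt_le; intros Hlt.
  assert (Hcont : continuity (fun s => h s zero - g s zero)).
  { intros s. apply derivable_continuous_pt.
    exists (- gradW S r (h s) zero - - gradW S r (g s) zero).
    apply (derivable_pt_lim_minus (fun s => h s zero) (fun s => g s zero)); now apply flow_line_derivable. }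
  assert (E : exists s, h s zero - g s zero = 0).
  { destruct (Rle_lt_dec 0 t).
    - destruct (IVT_cor (fun s => h s zero - g s zero) 0 t Hcont r0) as [s [_ Hs]]; [|eauto].
      rewrite Hg0, Hh0. specialize (Hxy zero). nra.
    - destruct (IVT_cor (fun s => h s zero - g s zero) t 0 Hcont) as [s [_ Hs]]; [lra| |eauto].
      rewrite Hg0, Hh0. specialize (Hxy zero). nra. }
  destruct E as [s Hs].
  assert (Heq : g s = h s) by (apply (ghost_eq (g s) (h s) zero); auto; lra).
  pose proof (flow_line_unique S r g h s HS Hg Hh Heq t) as Ht. rewrite Ht in Hlt. lra.
Qed.

End GhostCircle.

(** * Approximating sequences of ghost circles *)

Definition linear_growth {d} (W : R) (x : Config d) : Prop :=
  forall j m, Rabs (x (zadd j m) - x j) <= 1 + W * IZR (lnorm m).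

Lemma linear_growth_abs {d} W (x : Config d) i : linear_growth W x ->
  Rabs (x i) <= Rabs (x zero) + 1 + W * IZR (lnorm i).
Proof.
  intros H. specialize (H zero i). rewrite zadd_zero_l in H.
  replace (x i) with (x zero + (x i - x zero)) by lra. eapply Rle_trans; [apply Rabs_triang|lra].
Qed.

(** Write [3/4 = 1/2 * 3/2]; Bernoulli's inequality [(3/2)^n >= 1 + n/2] lets the factor [(3/2)^n]
    absorb the linear growth. *)
Lemma wt_linear {d} A W (i : Zd d) : 0 <= A -> 0 <= W ->
  wt i * (A + W * IZR (lnorm i)) <= (A + 2 * W) * geo (3/4) i.
Proof.
  intros HA HW. set (n := Z.to_nat (lnorm i)).
  assert (En : IZR (lnorm i) = INR n).
  { rewrite INR_IZR_INZ. f_equal. pose proof (lnorm_nonneg i). lia. }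
  assert (E : geo (3/4) i = wt i * (3/2) ^ n).
  { unfold wt, geo. fold n. rewrite <- Rpow_mult_distr. f_equal; lra. }
  rewrite E, En. rewrite (Rmult_comm (A + 2 * W)), Rmult_assoc.
  apply Rmult_le_compat_l; [left; apply wt_pos|].
  pose proof (poly n (1/2) ltac:(lra)) as P. replace (1 + 1/2) with (3/2) in P by lra.
  pose proof (pos_INR n).
  assert (A * 1 <= A * (3/2)^n) by (apply Rmult_le_compat_l; lra).
  assert (2 * W * (1 + INR n * (1/2)) <= 2 * W * (3/2)^n) by (apply Rmult_le_compat_l; lra).
  lra.
Qed.

Lemma linear_growth_inX {d} W (x : Config d) : 0 <= W -> linear_growth W x -> inX x.
Proof.
  intros HW Hx. set (A := Rabs (x zero) + 1). assert (HA : 0 <= A) by (unfold A; pose proof (Rabs_pos (x zero)); lra).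
  exists ((A + 2 * W) * 7 ^ d). intros L HL. rewrite wsum_wt.
  apply Rle_trans with (lsum (fun i => (A + 2 * W) * geo (3/4) i) L).
  - apply lsum_le. intros i _. eapply Rle_trans; [|now apply wt_linear].
    apply Rmult_le_compat_l; [left; apply wt_pos|]. now apply linear_growth_abs.
  - rewrite lsum_scal. apply Rmult_le_compat_l; [lra|]. now apply geo_summable.
Qed.

Lemma eventually_list {A} (P : A -> nat -> Prop) (L : list A) :
  (forall i, In i L -> exists N, forall n, (N <= n)%nat -> P i n) ->
  exists N, forall n, (N <= n)%nat -> forall i, In i L -> P i n.
Proof.
  induction L as [|a L IH]; intros H; [exists O; intros n _ i []|].
  destruct IH as [N1 H1]; [intros; apply H; now right|].
  destruct (H a (or_introl eq_refl)) as [N2 H2].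
  exists (Nat.max N1 N2). intros n Hn i [<-|Hi]; [apply H2; lia|apply H1; auto; lia].
Qed.

(** Pointwise convergence settles the finitely many sites of a box, and the common linear growth
    makes the weighted difference uniformly small outside it. This provides the initial estimate for
    [flow_line_compare]. *)
Lemma pw_cv_weighted {d} (a : nat -> Config d) x W : 0 <= W -> (forall n, linear_growth W (a n)) ->
  linear_growth W x -> pw_cv a x ->
  forall eta, 0 < eta -> exists N, forall n, (N <= n)%nat -> forall i, wt i * Rabs (a n i - x i) <= eta.
Proof.
  intros HW Ha Hx Hcv eta Heta.
  destruct (Un_cv_bounded _ _ (Hcv zero)) as [M HM].
  set (A := M + Rabs (x zero) + 2).
  assert (HA : 0 <= A).
  { unfold A. pose proof (Rabs_pos (x zero)). pose proof (Rle_trans _ _ _ (Rabs_pos _) (HM O)). lra. }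
  assert (Hdiff : forall n i, Rabs (a n i - x i) <= A + 2 * W * IZR (lnorm i)).
  { intros n i. pose proof (linear_growth_abs W (a n) i (Ha n)). pose proof (linear_growth_abs W x i Hx).
    specialize (HM n). unfold A. unfold Rminus. eapply Rle_trans; [apply Rabs_triang|]. rewrite Rabs_Ropp. lra. }
  set (C := A + 2 * (2 * W)).
  destruct (pow_lt_1_zero (3/4)) with (y := eta / (C + 1)) as [m0 Hm0].
  { rewrite Rabs_pos_eq; lra. }
  { apply Rdiv_lt_0_compat; unfold C; lra. }
  destruct (eventually_list (fun i n => Rabs (a n i - x i) < eta) (box d m0)) as [N HN].
  { intros i _. destruct (Hcv i eta Heta) as [N HN]. exists N. intros n Hn. apply HN; lia. }
  exists N. intros n Hn i. destruct (Z_le_gt_dec (lnorm i) (Z.of_nat m0)) as [Hi|Hi].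
  - specialize (HN n Hn i (in_box m0 i Hi)). pose proof (wt_le1 i).
    apply Rle_trans with (1 * Rabs (a n i - x i)); [|lra].
    apply Rmult_le_compat_r; [apply Rabs_pos|assumption].
  - apply Rle_trans with (wt i * (A + 2 * W * IZR (lnorm i))).
    { apply Rmult_le_compat_l; [left; apply wt_pos|apply Hdiff]. }
    eapply Rle_trans; [apply wt_linear; [assumption|lra]|]. fold C.
    specialize (Hm0 (Z.to_nat (lnorm i)) ltac:(lia)). rewrite Rabs_pos_eq in Hm0 by (apply pow_le; lra).
    fold (geo (3/4) i) in Hm0.
    assert (HC : 0 <= C) by (unfold C; lra).
    apply Rle_trans with ((C + 1) * (eta / (C + 1))); [|right; field; lra].
    apply Rmult_le_compat; try lra. left; apply geo_pos; lra.
Qed.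

(** Bundled into one predicate that is stable under extraction, so that every result on a sequence
    can be reapplied to its subsequences. *)
Definition ghost_approximation {d} (Sn : nat -> Pot d) (Sinf : Pot d) (r : R)
  (Gs : nat -> Config d -> Prop) (ws : nat -> Rd d) (winf : Rd d) : Prop :=
  (forall n, local_potentials (Sn n) r) /\ local_potentials Sinf r /\
  (forall eps, 0 < eps -> exists N, forall n, (N <= n)%nat ->
      C1norm_grad_le (fun x => Sn n zero x - Sinf zero x) eps) /\
  (forall n, ghost_circle (Sn n) r (Gs n) /\ ghost_rot (Gs n) (ws n)) /\ Rd_cv ws winf.

Lemma ghost_approximation_extraction {d} Sn Sinf r (Gs : nat -> Config d -> Prop) ws winf phi :
  ghost_approximation Sn Sinf r Gs ws winf -> extraction phi ->
  ghost_approximation (fun m => Sn (phi m)) Sinf r (fun m => Gs (phi m)) (fun m => ws (phi m)) winf.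
Proof.
  intros [H1 [H2 [H3 [H4 H5]]]] Hphi.
  split; [auto|]. split; [exact H2|]. split; [|split; [auto|]].
  - intros eps Heps. destruct (H3 eps Heps) as [N HN]. exists N. intros n Hn. apply HN.
    pose proof (extraction_ge phi n Hphi). lia.
  - intros k. apply (Un_cv_extraction (fun n => Vector.nth (ws n) k)); [assumption|apply H5].
Qed.

Section Limit.
Context {d : nat} (Sn : nat -> Pot d) (Sinf : Pot d) (r : R) (Gs : nat -> Config d -> Prop)
  (ws : nat -> Rd d) (winf : Rd d).
Hypothesis H : ghost_approximation Sn Sinf r Gs ws winf.

Let HSn n : local_potentials (Sn n) r. Proof. apply H. Qed.
Let HSinf : local_potentials Sinf r. Proof. apply H. Qed.
Let HGs n : ghost_circle (Sn n) r (Gs n). Proof. apply H. Qed.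
Let Hrot n : ghost_rot (Gs n) (ws n). Proof. apply H. Qed.

Lemma approx_growth : exists W, 0 <= W /\ forall n x, Gs n x -> linear_growth W x.
Proof.
  destruct (Rd_cv_ip ws winf) as [[W HW] _]; [apply H|]. exists W. split.
  { eapply Rle_trans; [apply (l1norm_nonneg (ws O))|apply (HW O)]. }
  intros n x Hx j m. eapply Rle_trans; [apply (ghost_rot_growth (Sn n) r (Gs n) (HGs n) (ws n)); auto|].
  specialize (HW n). apply Rplus_le_compat_l, Rmult_le_compat_r; [|assumption].
  apply IZR_le, lnorm_nonneg.
Qed.

Lemma pw_cv_growth W a (x : Config d) : (forall n, linear_growth W (a n)) -> pw_cv a x -> linear_growth W x.
Proof.
  intros Ha Hcv j m. apply (Un_cv_abs_le (fun n => a n (zadd j m) - a n j)); [|intros; apply Ha].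
  apply CV_minus; apply Hcv.
Qed.

Lemma limit_rot_bound a x i : (forall n, Gs n (a n)) -> pw_cv a x -> Rabs (x i - x zero - ip winf i) <= 1.
Proof.
  intros Ha Hcv. apply (Un_cv_abs_le (fun n => a n i - a n zero - ip (ws n) i)).
  - apply CV_minus; [apply CV_minus; apply Hcv|]. apply Rd_cv_ip. apply H.
  - intros n. now apply (ghost_rot_bound (Sn n) r (Gs n)).
Qed.

Lemma limit_flow_line a x gn g : (forall n, Gs n (a n)) -> pw_cv a x ->
  (forall n, flow_line (Sn n) r (gn n)) -> (forall n, gn n 0 = a n) ->
  flow_line Sinf r g -> g 0 = x -> forall t, pw_cv (fun n => gn n t) (g t).
Proof.
  intros Ha Hcv Hgn Hgn0 Hg Hg0 t i eps Heps.
  destruct approx_growth as [W [HW HWG]].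
  assert (HaW : forall n, linear_growth W (a n)) by (intros; eapply HWG; eauto).
  pose proof (pw_cv_growth W a x HaW Hcv) as HxW.
  destruct (flow_line_compare Sinf r HSinf) as [Lam [HL Hcmp]].
  set (E := exp ((Lam + 1) * Rabs t)). assert (HE : 0 < E) by apply exp_pos.
  pose proof (wt_pos i) as Hw.
  (* With this [K] the Gronwall bound at time [t] is half of [eps * wt i]; the initial distance and
     the field discrepancy are then both made at most [K / 2]. *)
  set (K := eps * wt i / 2 / E).
  assert (Hew : 0 < eps * wt i) by (now apply Rmult_lt_0_compat).
  assert (HK : 0 < K) by (unfold K; apply Rdiv_lt_0_compat; lra).
  destruct (pw_cv_weighted a x W HW HaW HxW Hcv (K / 2)) as [N1 H1]; [lra|].
  pose proof (ball_card_nonneg d r) as Hn.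
  destruct (proj1 (proj2 (proj2 H)) (K / 2 / (ball_card d r + 1))) as [N2 H2].
  { apply Rdiv_lt_0_compat; lra. }
  exists (Nat.max N1 N2). intros n Hnn. unfold Rdist.
  assert (P : wt i * Rabs (gn n t i - g t i) <= K * E).
  { apply (Hcmp (Sn n) (gn n) g (K / 2) (ball_card d r * (K / 2 / (ball_card d r + 1))) K); auto; try lra.
    - apply gradW_close; auto. apply H2; lia.
    - split; [apply Rmult_le_pos; [assumption|left; apply Rdiv_lt_0_compat; lra]|].
      apply Rle_lt_trans with ((ball_card d r + 1) * (K / 2 / (ball_card d r + 1))).
      + apply Rmult_le_compat_r; [left; apply Rdiv_lt_0_compat; lra|lra].
      + replace ((ball_card d r + 1) * (K / 2 / (ball_card d r + 1))) with (K / 2) by (field; lra). lra.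
    - intros k. rewrite Hgn0, Hg0. apply H1; lia. }
  apply (Rmult_lt_reg_l (wt i)); [assumption|]. eapply Rle_lt_trans; [exact P|].
  unfold K, Rdiv. rewrite Rmult_assoc, Rinv_l by lra. lra.
Qed.

Lemma limit_le_trichotomy a b x y : (forall n, Gs n (a n)) -> (forall n, Gs n (b n)) ->
  pw_cv a x -> pw_cv b y -> (forall N, exists n, (N <= n)%nat /\ forall i, a n i <= b n i) ->
  sll x y \/ x = y.
Proof.
  intros Ha Hb Hax Hby Hle. destruct approx_growth as [W [HW HWG]].
  assert (Hlin : forall c z, (forall n, Gs n (c n)) -> pw_cv c z ->
    exists g gn, flow_line Sinf r g /\ g 0 = z /\ (forall n, flow_line (Sn n) r (gn n) /\ gn n 0 = c n)).
  { intros c z Hc Hcz.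
    assert (HzW : linear_growth W z) by (apply (pw_cv_growth W c); [intros; eapply HWG|]; eauto).
    destruct (flow_line_exists Sinf r z W HSinf) as [g [Hg Hg0]]; auto.
    { now apply (linear_growth_inX W). }
    exists g, (fun n => epsilon (inhabits g) (fun g => flow_line (Sn n) r g /\ g 0 = c n)).
    split; [assumption|]. split; [assumption|]. intros n. apply epsilon_spec.
    destruct (ghost_flow_line (Sn n) r (Gs n) (HGs n) (HSn n) (ws n) (c n)) as [gn [H1 [H2 _]]]; eauto. }
  destruct (Hlin a x Ha Hax) as [g [gn [Hg [Hg0 Hgn]]]].
  destruct (Hlin b y Hb Hby) as [h [hn [Hh [Hh0 Hhn]]]].
  rewrite <- Hg0, <- Hh0. apply (flow_line_strong_comparison Sinf r); auto.
  intros t i. apply (Un_cv_frequently_le (fun n => gn n t i) (fun n => hn n t i)).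
  - apply (limit_flow_line a x gn g); auto; intros; apply Hgn.
  - apply (limit_flow_line b y hn h); auto; intros; apply Hhn.
  - intros N. destruct (Hle N) as [n [Hn Hi]]. exists n. split; [assumption|].
    apply (ghost_flow_line_le (Sn n) r (Gs n) (HGs n) (HSn n) (a n) (b n)); auto; apply Hgn || apply Hhn.
Qed.

(** Either [a n <= b n] for infinitely many [n], or [b n <= a n] for all large [n] by the order
    inside each circle; one direction of the comparison applies in each case. *)
Lemma limit_trichotomy a b x y : (forall n, Gs n (a n)) -> (forall n, Gs n (b n)) ->
  pw_cv a x -> pw_cv b y -> sll x y \/ x = y \/ sll y x.
Proof.
  intros Ha Hb Hax Hby.
  destruct (classic (forall N, exists n, (N <= n)%nat /\ forall i, a n i <= b n i)) as [Hle|Hn].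
  - destruct (limit_le_trichotomy a b x y) as [|]; auto.
  - destruct (limit_le_trichotomy b a y x) as [|]; auto.
    apply not_all_ex_not in Hn as [N HN]. intros N'. exists (Nat.max N N'). split; [lia|].
    set (n := Nat.max N N').
    destruct (ghost_trichotomy (Sn n) r (Gs n) (HGs n) (a n) (b n)) as [Hlt|[Heq|Hlt]]; auto.
    + contradiction HN. exists n. split; [lia|]. intros i; left; apply Hlt.
    + intros i; right; now rewrite Heq.
    + intros i; left; apply Hlt.
Qed.

Lemma limit_eq a b x y i : (forall n, Gs n (a n)) -> (forall n, Gs n (b n)) ->
  pw_cv a x -> pw_cv b y -> x i = y i -> x = y.
Proof.
  intros Ha Hb Hax Hby Hi. destruct (limit_trichotomy a b x y) as [Hlt|[|Hlt]]; auto; specialize (Hlt i); lra.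
Qed.

End Limit.

(** * The limit circle *)

(** The lower Kuratowski limit of the circles in the pointwise topology. The formulation by
    neighbourhoods makes closedness a matter of halving [eps]. *)
Definition limit_set {d} (Gs : nat -> Config d -> Prop) : Config d -> Prop :=
  fun x => forall L eps, 0 < eps -> exists N, forall n, (N <= n)%nat ->
    exists y, Gs n y /\ forall i, In i L -> Rabs (y i - x i) < eps.

Lemma pw_cv_eventually {d} a (x : Config d) L eps : pw_cv a x -> 0 < eps ->
  exists N, forall n, (N <= n)%nat -> forall i, In i L -> Rabs (a n i - x i) < eps.
Proof.
  intros Hcv Heps. apply (eventually_list (fun i n => Rabs (a n i - x i) < eps)).
  intros i _. destruct (Hcv i eps Heps) as [N HN]. exists N. intros n Hn. apply HN; lia.
Qed.

Lemma limit_set_of_seq {d} (Gs : nat -> Config d -> Prop) a x :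
  (forall n, Gs n (a n)) -> pw_cv a x -> limit_set Gs x.
Proof.
  intros Ha Hcv L eps Heps. destruct (pw_cv_eventually a x L eps Hcv Heps) as [N HN].
  exists N. intros n Hn. exists (a n). auto.
Qed.

(** The lattice is countable, so the neighbourhoods [close k], which constrain [k + 1] sites to
    precision [1 / (k + 1)], form a countable base at [x]. One element per circle must serve all
    levels at once. *)
Lemma limit_set_seq {d} (Gs : nat -> Config d -> Prop) x : (forall n, exists y, Gs n y) ->
  limit_set Gs x -> exists a, (forall n, Gs n (a n)) /\ pw_cv a x.
Proof.
  intros Hne Hx. destruct (Zd_countable d) as [e He].
  set (close := fun k (y : Config d) => forall j, (j <= k)%nat -> Rabs (y (e j) - x (e j)) < / INR (S k)).
  assert (Hmono : forall k k' y, (k <= k')%nat -> close k' y -> close k y).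
  { intros k k' y Hk Hc j Hj. eapply Rlt_le_trans; [apply Hc; lia|].
    apply Rinv_le_contravar; [apply lt_0_INR; lia|apply le_INR; lia]. }
  (* the best approximant among the first [m] precision levels *)
  assert (Hbest : forall n m, exists y, Gs n y /\ forall k, (k <= m)%nat ->
     (exists y', Gs n y' /\ close k y') -> close k y).
  { intros n. induction m.
    - destruct (classic (exists y', Gs n y' /\ close O y')) as [[y [H1 H2]]|Hn].
      + exists y. split; [assumption|]. intros k Hk _. now replace k with O by lia.
      + destruct (Hne n) as [y Hy]. exists y. split; [assumption|]. intros k Hk Hc.
        replace k with O in Hc by lia. contradiction.
    - destruct (classic (exists y', Gs n y' /\ close (S m) y')) as [[y [H1 H2]]|Hn].
      + exists y. split; [assumption|]. intros k Hk _. now apply (Hmono k (S m)).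
      + destruct IHm as [y [Hy IH]]. exists y. split; [assumption|]. intros k Hk Hc.
        destruct (Nat.eq_dec k (S m)) as [->|]; [contradiction|]. apply IH; [lia|assumption]. }
  exists (fun n => epsilon (inhabits x) (fun y => Gs n y /\ forall k, (k <= n)%nat ->
     (exists y', Gs n y' /\ close k y') -> close k y)).
  assert (Ha : forall n, let a := epsilon (inhabits x) (fun y => Gs n y /\ forall k, (k <= n)%nat ->
     (exists y', Gs n y' /\ close k y') -> close k y) in
     Gs n a /\ forall k, (k <= n)%nat -> (exists y', Gs n y' /\ close k y') -> close k a).
  { intros n. cbv zeta. apply epsilon_spec. apply Hbest. }
  split; [intros n; apply Ha|]. intros i eps Heps. destruct (He i) as [j <-].
  destruct (inv_INR_S_lt eps Heps) as [N1 HN1]. set (k := Nat.max N1 j).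
  destruct (Hx (map e (seq 0 (S k))) (/ INR (S k))) as [N2 HN2].
  { apply Rinv_0_lt_compat, lt_0_INR; lia. }
  exists (Nat.max k N2). intros n Hn. unfold Rdist.
  apply Rlt_trans with (/ INR (S k)); [|apply HN1; lia].
  apply (proj2 (Ha n) k); [lia| |lia].
  destruct (HN2 n ltac:(lia)) as [y [Hy Hc]]. exists y. split; [assumption|]. intros j' Hj'.
  apply Hc. apply in_map, in_seq; lia.
Qed.

Lemma limit_set_closed {d} (Gs : nat -> Config d -> Prop) : pw_closed (limit_set Gs).
Proof.
  intros x Hx. apply not_all_ex_not in Hx as [L Hx]. apply not_all_ex_not in Hx as [eps Hx].
  apply imply_to_and in Hx as [Heps Hx]. exists L, (eps / 2). split; [lra|]. intros y Hy Hlim. apply Hx.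
  destruct (Hlim L (eps / 2)) as [N HN]; [lra|]. exists N. intros n Hn.
  destruct (HN n Hn) as [z [Hz Hc]]. exists z. split; [assumption|]. intros i Hi.
  specialize (Hc i Hi). specialize (Hy i Hi).
  replace (z i - x i) with ((z i - y i) + (y i - x i)) by lra.
  eapply Rle_lt_trans; [apply Rabs_triang|lra].
Qed.

Lemma pw_closed_seq {d} (G : Config d -> Prop) a x : pw_closed G -> (forall n, G (a n)) -> pw_cv a x -> G x.
Proof.
  intros HG Ha Hcv. apply NNPP. intros Hn. destruct (HG x Hn) as [L [eps [Heps Hopen]]].
  destruct (pw_cv_eventually a x L eps Hcv Heps) as [N HN].
  apply (Hopen (a N)); [|apply Ha]. intros i Hi. now apply HN.
Qed.

(** Connectedness of the line: the indicator function of [P] has derivative zero everywhere, hence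
    is constant by the mean value theorem. *)
Lemma locally_constant (P : R -> Prop) :
  (forall s, exists delta, 0 < delta /\ forall t, Rabs (t - s) < delta -> (P t <-> P s)) ->
  forall s t, P s -> P t.
Proof.
  intros Hloc s t Hs. pose (f := fun u => if excluded_middle_informative (P u) then 1 else 0).
  assert (Hf : forall u, derivable_pt_lim f u 0).
  { intros u eps Heps. destruct (Hloc u) as [delta [Hd H]]. exists (mkposreal delta Hd). intros h Hh0 Hh.
    assert (f (u + h) = f u) as ->.
    { unfold f. specialize (H (u + h)). replace (u + h - u) with h in H by lra. specialize (H Hh).
      repeat destruct excluded_middle_informative; tauto. }
    replace ((f u - f u) / h - 0) with 0 by (field; assumption). now rewrite Rabs_R0. }
  destruct (mean_value f (fun _ => 0) s t Hf) as [c [_ Hc]].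
  unfold f in Hc. repeat destruct excluded_middle_informative; try tauto; lra.
Qed.

(** * Passage of global minimality to the limit *)

Lemma Un_cv_lsum {A} (u : nat -> A -> R) (l : A -> R) L : (forall a, In a L -> Un_cv (fun n => u n a) (l a)) ->
  Un_cv (fun n => lsum (u n) L) (lsum l L).
Proof.
  induction L as [|a L IH]; intros H; [apply (Un_cv_const 0)|].
  apply (CV_plus (fun n => u n a) (fun n => lsum (u n) L)); [apply H; now left|].
  apply IH. intros b Hb; apply H; now right.
Qed.

Lemma pot_continuous {d} (S : Pot d) r a x j : local_potentials S r -> pw_cv a x ->
  Un_cv (fun n => S j (a n)) (S j x).
Proof.
  intros HS Hcv eps Heps. destruct HS as [[_ HA] _]. destruct (HA j) as [_ [Hc _]].
  destruct (Hc x eps Heps) as [delta [Hd Hdelta]].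
  destruct (pw_cv_eventually a x (ball_list r j) delta Hcv Hd) as [N HN].
  exists N. intros n Hn. apply Hdelta. intros k Hk. apply HN; [lia|]. now apply in_ball_list.
Qed.

Lemma global_min_tau {d} (S : Pot d) r x l : local_potentials S r -> global_min S r x ->
  global_min S r (tau zero l x).
Proof.
  intros HS Hx B y HB Hy. destruct HS as [_ [HTr _]].
  assert (E : forall j z, S j (tau zero l z) = S j z) by (intros; now rewrite HTr, zadd_zero_r).
  rewrite (lsum_ext (fun j => S j (tau zero l x)) (fun j => S j x)) by (intros; apply E).
  rewrite (lsum_ext (fun j => S j (fun i => tau zero l x i + y i)) (fun j => S j (fun i => x i + y i)));
    [now apply Hx|].
  intros j _. rewrite <- (E j (fun i => x i + y i)). f_equal.
  apply functional_extensionality; intros i. unfold tau. rewrite zadd_zero_r. lra.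
Qed.

(* Only differences S(x+y) - S(x) enter minimality, and these are controlled by the gradients alone. *)
Lemma pot_difference_close {d} (S S' : Pot d) r eps : local_potentials S r -> local_potentials S' r ->
  C1norm_grad_le (fun x => S zero x - S' zero x) eps ->
  forall j x y, Rabs ((S j y - S' j y) - (S j x - S' j x)) <=
    eps * lsum (fun k => Rabs (y k - x k)) (ball_list r j).
Proof.
  intros HS HS' Hc j.
  assert (Hd : forall k z, has_pd (fun x => S j x - S' j x) k z).
  { intros k z. exists (pd (S j) k z - pd (S' j) k z).
    apply (derivable_pt_lim_minus (fun t => S j (upd z k t)) (fun t => S' j (upd z k t))); apply pd_spec;
      [apply (pot_has_pd S r HS)|apply (pot_has_pd S' r HS')]. }
  apply (pd_bounded_lipschitz (fun x => S j x - S' j x) (ball j r)).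
  - intros x y Hxy. now rewrite (pot_depends S r HS j x y Hxy), (pot_depends S' r HS' j x y Hxy).
  - intros k; apply in_ball_list.
  - exact Hd.
  - intros k z. rewrite pd_minus by ((apply (pot_has_pd S r HS)) || apply (pot_has_pd S' r HS')).
    rewrite (pd_translate S r HS j 0), (pd_translate S' r HS' j 0), <- pd_minus.
    + now apply C1norm_pd_le.
    + apply (pot_has_pd S r HS).
    + apply (pot_has_pd S' r HS').
Qed.

(** [V] is the energy cost of adding [y], measured with the limit potentials. Replacing [Sn n] by
    [Sinf] changes the cost by at most [eps * C], where [C] depends only on [y] and [B], so
    minimality of [a n] gives [V x >= - eps * C] for every positive [eps]. *)
Lemma global_min_limit {d} (Sn : nat -> Pot d) Sinf r a x :
  (forall n, local_potentials (Sn n) r) -> local_potentials Sinf r ->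
  (forall eps, 0 < eps -> exists N, forall n, (N <= n)%nat ->
      C1norm_grad_le (fun x => Sn n zero x - Sinf zero x) eps) ->
  pw_cv a x -> (forall n, global_min (Sn n) r (a n)) -> global_min Sinf r x.
Proof.
  intros HSn HSinf Hconv Hcv Hmin B y HB Hy.
  set (C := lsum (fun j => lsum (fun k => Rabs (y k)) (ball_list r j)) B).
  assert (HC : 0 <= C) by (apply lsum_nonneg; intros; apply lsum_nonneg; intros; apply Rabs_pos).
  set (V := fun z : Config d => lsum (fun j => Sinf j (fun i => z i + y i) - Sinf j z) B).
  assert (HV : Un_cv (fun n => V (a n)) (V x)).
  { apply Un_cv_lsum. intros j _. apply CV_minus; [|now apply (pot_continuous Sinf r)].
    apply (pot_continuous Sinf r (fun n i => a n i + y i) (fun i => x i + y i)); auto.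
    intros i. apply (CV_plus (fun n => a n i)); [apply Hcv|apply Un_cv_const]. }
  assert (Hge : forall eps, 0 < eps -> - (eps * C) <= V x).
  { intros eps Heps. destruct (Hconv eps Heps) as [N HN].
    apply (Un_cv_frequently_le (fun _ => - (eps * C)) (fun n => V (a n))); auto; [apply Un_cv_const|].
    intros N'. exists (Nat.max N N'). split; [lia|]. set (n := Nat.max N N').
    pose proof (Hmin n B y HB Hy) as Hm.
    assert (Hdiff : lsum (fun j => (Sn n j (fun i => a n i + y i) - Sn n j (a n))
      - (Sinf j (fun i => a n i + y i) - Sinf j (a n))) B <= eps * C).
    { unfold C. rewrite <- lsum_scal. apply lsum_le. intros j _.
      pose proof (pot_difference_close (Sn n) Sinf r eps (HSn n) HSinf (HN n ltac:(lia)) j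
        (a n) (fun i => a n i + y i)) as P.
      rewrite (lsum_ext (fun k => Rabs (a n k + y k - a n k)) (fun k => Rabs (y k))) in P
        by (intros; f_equal; lra).
      eapply Rle_trans; [|exact P]. eapply Rle_trans; [|apply Rle_abs]. lra. }
    rewrite lsum_minus in Hdiff. rewrite (lsum_minus (fun j => Sn n j (fun i => a n i + y i))) in Hdiff.
    unfold V. lra. }
  assert (0 <= V x).
  { apply Rnot_lt_le; intros Hlt. specialize (Hge (- V x / (2 * (C + 1)))).
    assert (Hp : 0 < - V x / (2 * (C + 1))) by (apply Rdiv_lt_0_compat; lra). specialize (Hge Hp).
    assert (- V x / (2 * (C + 1)) * C <= - V x / (2 * (C + 1)) * (C + 1)) by (apply Rmult_le_compat_l; lra).
    replace (- V x / (2 * (C + 1)) * (C + 1)) with (- V x / 2) in H by (field; lra). lra. }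
  unfold V in H. rewrite lsum_minus in H. lra.
Qed.

Section LimitCircle.
Context {d : nat} (Sn : nat -> Pot d) (Sinf : Pot d) (r : R) (Gs : nat -> Config d -> Prop)
  (ws : nat -> Rd d) (winf : Rd d).
Hypothesis H : ghost_approximation Sn Sinf r Gs ws winf.
(** This is what the diagonal extraction over rational values provides; compactness upgrades it to
    all real values in [limit_set_param]. *)
Hypothesis Hdense : forall xi eps, 0 < eps -> exists x, limit_set Gs x /\ Rabs (x zero - xi) < eps.

Let HSn n : local_potentials (Sn n) r. Proof. apply H. Qed.
Let HSinf : local_potentials Sinf r. Proof. apply H. Qed.
Let HGs n : ghost_circle (Sn n) r (Gs n). Proof. apply H. Qed.
Let Hrot n : ghost_rot (Gs n) (ws n). Proof. apply H. Qed.

Let seq x : limit_set Gs x -> exists a, (forall n, Gs n (a n)) /\ pw_cv a x.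
Proof. apply limit_set_seq. intros n. apply HGs. Qed.

Lemma limit_set_trichotomy x y : limit_set Gs x -> limit_set Gs y -> sll x y \/ x = y \/ sll y x.
Proof.
  intros Hx Hy. destruct (seq x Hx) as [a [Ha Hax]]. destruct (seq y Hy) as [b [Hb Hby]].
  now apply (limit_trichotomy Sn Sinf r Gs ws winf H a b).
Qed.

Lemma limit_set_eq x y i : limit_set Gs x -> limit_set Gs y -> x i = y i -> x = y.
Proof.
  intros Hx Hy Hi. destruct (limit_set_trichotomy x y Hx Hy) as [Hlt|[|Hlt]]; auto; specialize (Hlt i); lra.
Qed.

Lemma limit_set_growth : exists W, 0 <= W /\ forall x, limit_set Gs x -> linear_growth W x.
Proof.
  destruct (approx_growth Sn Sinf r Gs ws winf H) as [W [HW HWG]]. exists W. split; [assumption|].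
  intros x Hx. destruct (seq x Hx) as [a [Ha Hax]]. apply (pw_cv_growth W a); auto. intros n; eapply HWG; eauto.
Qed.

Lemma limit_set_tau k l x : limit_set Gs x -> limit_set Gs (tau k l x).
Proof.
  intros Hx. destruct (seq x Hx) as [a [Ha Hax]].
  apply (limit_set_of_seq Gs (fun n => tau k l (a n))).
  - intros n. now apply (ghost_tau (Sn n) r).
  - intros i. apply (CV_plus (fun n => a n (zadd i k))); [apply Hax|apply Un_cv_const].
Qed.

Lemma limit_set_compact a : (forall n, limit_set Gs (a n)) -> (exists M, forall n, Rabs (a n zero) <= M) ->
  exists phi x, extraction phi /\ pw_cv (fun m => a (phi m)) x /\ limit_set Gs x.
Proof.
  intros Ha [M HM]. destruct limit_set_growth as [W [HW HWG]].
  destruct (config_compact a) as [phi [x [Hphi Hx]]].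
  - intros i. exists (M + 1 + W * IZR (lnorm i)). intros n.
    pose proof (linear_growth_abs W (a n) i (HWG _ (Ha n))). specialize (HM n). lra.
  - exists phi, x. repeat split; auto.
    apply (pw_closed_seq (limit_set Gs) (fun m => a (phi m))); auto using limit_set_closed.
Qed.

Let near_limit a xi phi (x : Config d) : (forall p, Rabs (a p zero - xi) < / INR (S p)) -> extraction phi ->
  pw_cv (fun m : nat => a (phi m)) x -> x zero = xi.
Proof.
  intros Ha Hphi Hx. apply (UL_sequence (fun m => a (phi m) zero)); [apply Hx|].
  apply (Un_cv_extraction (fun n => a n zero)); [assumption|].
  intros eps Heps. destruct (inv_INR_S_lt eps Heps) as [N HN].
  exists N. intros n Hn. unfold Rdist. eapply Rlt_trans; [apply Ha|apply HN; lia].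
Qed.

Let near_bounded (a : nat -> Config d) xi : (forall p, Rabs (a p zero - xi) < / INR (S p)) ->
  exists M, forall n, Rabs (a n zero) <= M.
Proof.
  intros Ha. exists (Rabs xi + 1). intros n. specialize (Ha n).
  assert (/ INR (S n) <= 1).
  { rewrite <- Rinv_1. apply Rinv_le_contravar; [lra|]. replace 1 with (INR 1) by reflexivity. apply le_INR; lia. }
  replace (a n zero) with (xi + (a n zero - xi)) by lra. eapply Rle_trans; [apply Rabs_triang|lra].
Qed.

Lemma limit_set_param xi : exists x, limit_set Gs x /\ x zero = xi.
Proof.
  destruct (choice (fun p x => limit_set Gs x /\ Rabs (x zero - xi) < / INR (S p))) as [a Ha].
  { intros p. apply Hdense. apply Rinv_0_lt_compat, lt_0_INR; lia. }
  destruct (limit_set_compact a) as [phi [x [Hphi [Hx HL]]]].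
  - intros n; apply Ha.
  - apply (near_bounded a xi). intros p; apply Ha.
  - exists x. split; [assumption|]. apply (near_limit a xi phi x); auto. intros p; apply Ha.
Qed.

(** A failure would give elements that stay away from [x] on [L] while their zeroth coordinates tend
    to [x zero]; by compactness some of them converge, and rigidity identifies the limit with
    [x]. *)
Lemma limit_set_continuous x L eps : limit_set Gs x -> 0 < eps ->
  exists delta, 0 < delta /\ forall y, limit_set Gs y -> Rabs (y zero - x zero) < delta ->
    forall i, In i L -> Rabs (y i - x i) < eps.
Proof.
  intros Hx Heps. apply NNPP. intros Hn.
  destruct (choice (fun (p : nat) y => limit_set Gs y /\ Rabs (y zero - x zero) < / INR (S p) /\
    ~ forall i, In i L -> Rabs (y i - x i) < eps)) as [a Ha].
  { intros p. apply NNPP. intros Hp. apply Hn. exists (/ INR (S p)).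
    split; [apply Rinv_0_lt_compat, lt_0_INR; lia|]. intros y Hy Hyx. apply NNPP. intros Hc. apply Hp. eauto. }
  destruct (limit_set_compact a) as [phi [z [Hphi [Hz HL]]]].
  { intros n; apply Ha. }
  { apply (near_bounded a (x zero)). intros p; apply Ha. }
  assert (z = x) as ->.
  { apply (limit_set_eq z x zero); auto. apply (near_limit a (x zero) phi z); auto. intros p; apply Ha. }
  destruct (pw_cv_eventually _ x L eps Hz Heps) as [N HN].
  apply (proj2 (proj2 (Ha (phi N)))). now apply HN.
Qed.

(** The zeroth coordinate parametrises the limit set by the line. In a separation by [U] and [V],
    membership in [U] of the element with coordinate [t] is locally constant in [t], by continuity
    of the parametrisation. *)
Lemma limit_set_connected : pw_connected (limit_set Gs).
Proof.
  intros [U [V [HU [HV [Hcov [[u [Gu Uu]] [[v [Gv Vv]] Hdisj]]]]]]].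
  assert (Hloc : forall (U : Config d -> Prop) x, pw_open U -> limit_set Gs x -> U x -> exists delta, 0 < delta /\
    forall y, limit_set Gs y -> Rabs (y zero - x zero) < delta -> U y).
  { intros O x HO Hx Ox. destruct (HO x Ox) as [L [eps [Heps Hop]]].
    destruct (limit_set_continuous x L eps Hx Heps) as [delta [Hd Hc]]. exists delta; split; [assumption|].
    intros y Hy Hyx. apply Hop. now apply Hc. }
  assert (HP : forall t, exists delta, 0 < delta /\ forall s, Rabs (s - t) < delta ->
    ((exists x, limit_set Gs x /\ x zero = s /\ U x) <-> (exists x, limit_set Gs x /\ x zero = t /\ U x))).
  { intros t. destruct (limit_set_param t) as [x [Hx Hxt]]. destruct (Hcov x Hx) as [Ux|Vx].
    - destruct (Hloc U x HU Hx Ux) as [delta [Hd Hc]]. exists delta; split; [assumption|].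
      intros s Hs. split; intros _; [eauto|]. destruct (limit_set_param s) as [y [Hy Hys]].
      exists y. repeat split; auto. apply Hc; auto. now rewrite Hys, Hxt.
    - destruct (Hloc V x HV Hx Vx) as [delta [Hd Hc]]. exists delta; split; [assumption|].
      intros s Hs. split; intros [y [Hy [Hys Uy]]]; exfalso.
      + apply (Hdisj y); auto. apply Hc; auto. now rewrite Hys, Hxt.
      + apply (Hdisj y); auto. replace y with x; [assumption|]. apply (limit_set_eq x y zero); auto. lra. }
  destruct (locally_constant _ HP (u zero) (v zero)) as [y [Hy [Hyv Uy]]]; [now exists u|].
  apply (Hdisj v); auto. replace v with y; [assumption|]. now apply (limit_set_eq y v zero).
Qed.

Lemma limit_set_flow x g : limit_set Gs x -> flow_line Sinf r g -> g 0 = x -> forall t, limit_set Gs (g t).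
Proof.
  intros Hx Hg Hg0 t. destruct (seq x Hx) as [a [Ha Hax]].
  destruct (choice (fun n gn => flow_line (Sn n) r gn /\ gn 0 = a n /\ forall t, Gs n (gn t))) as [gn Hgn].
  { intros n. now apply (ghost_flow_line (Sn n) r (Gs n) (HGs n) (HSn n) (ws n)). }
  apply (limit_set_of_seq Gs (fun n => gn n t)); [intros; apply Hgn|].
  apply (limit_flow_line Sn Sinf r Gs ws winf H a x gn g); auto; intros; apply Hgn.
Qed.

Lemma limit_set_ghost_circle : ghost_circle Sinf r (limit_set Gs).
Proof.
  destruct limit_set_growth as [W [HW HWG]].
  split; [|split; [|split; [|split; [|split; [|split; [|split]]]]]].
  - destruct (limit_set_param 0) as [x [Hx _]]. eauto.
  - apply limit_set_closed.
  - apply limit_set_connected.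
  - apply limit_set_trichotomy.
  - intros k l x; apply limit_set_tau.
  - intros k l y Hy. exists (tau (zsub zero k) (- l) y). split; [now apply limit_set_tau|].
    apply functional_extensionality; intros i. unfold tau.
    replace (zadd (zadd i k) (zsub zero k)) with i by zd. rewrite opp_IZR; lra.
  - intros x Hx. now apply (linear_growth_inX W); auto.
  - intros x Hx g Hg Hg0. now apply (limit_set_flow x).
Qed.

(** The bound 1 in [limit_rot_bound] does not depend on the site, so at the sites [zscale n i] it
    disappears after division by [n]. *)
Lemma limit_set_rot : ghost_rot (limit_set Gs) winf.
Proof.
  intros x Hx i. destruct (seq x Hx) as [a [Ha Hax]].
  intros eps Heps. set (C := Rabs (x zero) + 1).
  assert (HC : 0 < C) by (unfold C; pose proof (Rabs_pos (x zero)); lra).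
  destruct (Un_cv_div_INR C eps Heps) as [N HN]. exists (S N). intros n Hn.
  specialize (HN n ltac:(lia)). unfold Rdist in *. rewrite Rminus_0_r in HN.
  assert (Hn0 : 0 < INR n) by (apply lt_0_INR; lia).
  eapply Rle_lt_trans; [|eapply Rle_lt_trans; [apply Rle_abs|exact HN]].
  pose proof (limit_rot_bound Sn Sinf r Gs ws winf H a x (zscale (Z.of_nat n) i) Ha Hax) as P.
  rewrite ip_zscale, <- INR_IZR_INZ in P. set (z := x (zscale (Z.of_nat n) i)) in *.
  replace (z / INR n - ip winf i) with (((z - x zero - INR n * ip winf i) + x zero) / INR n) by (field; lra).
  unfold Rdiv. rewrite Rabs_mult, (Rabs_pos_eq (/ INR n)) by (left; now apply Rinv_0_lt_compat).
  apply Rmult_le_compat_r; [left; now apply Rinv_0_lt_compat|].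
  eapply Rle_trans; [apply Rabs_triang|]. unfold C; lra.
Qed.

(** Membership in [limit_set] demands approximation along the full sequence, which [z] lacks a
    priori. Restricting the approximants of [x] to the same subsequence makes [x] and [z]
    comparable, and agreement at one site makes them equal. *)
Lemma limit_set_subsequence phi a x z : extraction phi -> (forall m, Gs (phi m) (a m)) -> pw_cv a z ->
  limit_set Gs x -> x zero = z zero -> z = x.
Proof.
  intros Hphi Ha Haz Hx E. destruct (seq x Hx) as [b [Hb Hbx]].
  apply (limit_eq _ Sinf r _ _ winf (ghost_approximation_extraction _ _ _ _ _ _ phi H Hphi)
    a (fun m => b (phi m)) z x zero); auto.
  intros i. now apply (Un_cv_extraction (fun n => b n i)).
Qed.

Lemma approx_compact phi a : extraction phi -> (forall m, Gs (phi m) (a m)) ->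
  (exists M, forall m, Rabs (a m zero) <= M) ->
  exists psi z, extraction psi /\ pw_cv (fun m => a (psi m)) z.
Proof.
  intros Hphi Ha [M HM]. destruct (approx_growth Sn Sinf r Gs ws winf H) as [W [HW HWG]].
  apply config_compact. intros i. exists (M + 1 + W * IZR (lnorm i)). intros n.
  pose proof (linear_growth_abs W (a n) i (HWG _ _ (Ha n))). specialize (HM n). lra.
Qed.

(** If convergence failed at a site, a subsequence would stay [eps] away from [x]; a convergent
    further subsequence has the same zeroth coordinate as [x], so it tends to [x], a
    contradiction. *)
Lemma limit_set_ghost_conv : ghost_conv Gs (limit_set Gs).
Proof.
  intros xi xs x Hxs Hx Hx0 i eps Heps. apply NNPP. intros Hn.
  destruct (extraction_exists (fun _ n => eps <= Rabs (xs n i - x i))) as [phi [Hphi Hfar]].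
  { intros _ N. apply NNPP. intros HN. apply Hn. exists N. intros n Hle. apply Rnot_le_lt. intros Hc.
    apply HN. exists n. split; [lia|exact Hc]. }
  destruct (approx_compact phi (fun m => xs (phi m)) Hphi) as [psi [z [Hpsi Hz]]].
  { intros m; apply Hxs. }
  { exists (Rabs xi). intros m. rewrite (proj2 (Hxs (phi m))). lra. }
  assert (z = x) as ->.
  { apply (limit_set_subsequence (fun m => phi (psi m)) (fun m => xs (phi (psi m)))); auto using extraction_comp.
    - intros m; apply Hxs.
    - rewrite Hx0. apply (UL_sequence (fun m => xs (phi (psi m)) zero)); [|apply Hz].
      apply (Un_cv_ext (fun _ => xi)); [|apply Un_cv_const]. intros n. symmetry; apply Hxs. }
  destruct (Hz i eps Heps) as [N HN]. specialize (HN N (le_n N)). specialize (Hfar (psi N)).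
  unfold Rdist in HN. lra.
Qed.

(** Vertical integer translation keeps both the circle and minimality and bounds the zeroth
    coordinates, so a subsequence of the minimizers converges; its limit is then recognised as an
    element of the limit set. *)
Lemma limit_set_global_min : (forall n, exists x, Gs n x /\ global_min (Sn n) r x) ->
  exists x, limit_set Gs x /\ global_min Sinf r x.
Proof.
  intros Hmin.
  destruct (choice (fun n x => Gs n x /\ global_min (Sn n) r x /\ Rabs (x zero) <= 1)) as [a Ha].
  { intros n. destruct (Hmin n) as [x [Hx Hm]]. exists (tau zero (- up (x zero)) x). split; [|split].
    - now apply (ghost_tau (Sn n) r).
    - now apply global_min_tau.
    - rewrite tau_zero_apply, opp_IZR. pose proof (archimed (x zero)). apply Rabs_le; lra. }
  assert (Hid : extraction (fun m => m)) by (intros m; lia).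
  destruct (approx_compact (fun m => m) a Hid) as [psi [z [Hpsi Hz]]].
  { intros m; apply Ha. }
  { exists 1; intros m; apply Ha. }
  destruct (limit_set_param (z zero)) as [x [Hx Hx0]].
  assert (z = x) as ->.
  { apply (limit_set_subsequence psi (fun m => a (psi m))); auto. intros m; apply Ha. }
  exists x. split; [assumption|].
  destruct (ghost_approximation_extraction _ _ _ _ _ _ psi H Hpsi) as [H1 [H2 [H3 _]]].
  apply (global_min_limit (fun m => Sn (psi m)) Sinf r (fun m => a (psi m))); auto. intros n; apply Ha.
Qed.

End LimitCircle.

(** * Choice of the subsequence and conclusion *)

Lemma rational_dense : exists q : nat -> R, forall xi eps, 0 < eps -> exists k, Rabs (q k - xi) < eps.
Proof.
  exists (fun k => let (a, m) := Cantor.of_nat k in let (u, v) := Cantor.of_nat a in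
    (INR u - INR v) / INR (S m)).
  intros xi eps Heps. destruct (inv_INR_S_lt eps Heps) as [m Hm]. specialize (Hm m (le_n m)).
  assert (HS : 0 < INR (S m)) by (apply lt_0_INR; lia).
  set (p := up (xi * INR (S m))).
  exists (Cantor.to_nat (Cantor.to_nat (Z.to_nat p, Z.to_nat (- p)), m)). rewrite !Cantor.cancel_of_to.
  assert (Ep : INR (Z.to_nat p) - INR (Z.to_nat (- p)) = IZR p).
  { rewrite !INR_IZR_INZ, <- minus_IZR. f_equal. lia. }
  rewrite Ep. eapply Rle_lt_trans; [|exact Hm].
  replace (IZR p / INR (S m) - xi) with ((IZR p - xi * INR (S m)) / INR (S m)) by (field; lra).
  unfold Rdiv. rewrite Rabs_mult, (Rabs_pos_eq (/ INR (S m))) by (left; now apply Rinv_0_lt_compat).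
  rewrite <- (Rmult_1_l (/ INR (S m))) at 2. apply Rmult_le_compat_r; [left; now apply Rinv_0_lt_compat|].
  pose proof (archimed (xi * INR (S m))). apply Rabs_le. fold p in H. lra.
Qed.

Theorem mainTheorem16 (d : nat) (K : Rd d -> Prop) (ws : nat -> Rd d) (winf : Rd d)
  (Sn : nat -> Pot d) (Sinf : Pot d) (r : R) (Gs : nat -> Config d -> Prop) :
  Rd_compact K ->
  (forall n, K (ws n)) -> K winf -> Rd_cv ws winf ->
  (forall n, local_potentials (Sn n) r) -> local_potentials Sinf r ->
  (forall eps, 0 < eps -> exists N, forall n, (N <= n)%nat ->
      C1norm_grad_le (fun x => Sn n zero x - Sinf zero x) eps) ->
  (forall n, ghost_circle (Sn n) r (Gs n) /\ ghost_rot (Gs n) (ws n)) ->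
  exists (Ginf : Config d -> Prop) (nm : nat -> nat),
    ghost_circle Sinf r Ginf /\ ghost_rot Ginf winf /\
    (forall m, (nm m < nm (S m))%nat) /\
    ghost_conv (fun m => Gs (nm m)) Ginf /\
    ((forall j eps, 0 < eps -> exists N, forall n, (N <= n)%nat ->
        forall x, in_BK K x -> Rabs (Sn n j x - Sinf j x) <= eps) ->
     (forall n, exists x, Gs n x /\ global_min (Sn n) r x) ->
     exists x, Ginf x /\ global_min Sinf r x).
Proof.
  intros _ _ _ Hws HSn HSinf Hconv HGs.
  assert (H : ghost_approximation Sn Sinf r Gs ws winf) by exact (conj HSn (conj HSinf (conj Hconv (conj HGs Hws)))).
  destruct rational_dense as [q Hq].
  destruct (choice (fun k (a : nat -> Config d) => forall n, Gs n (a n) /\ a n zero = q k)) as [a Ha].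
  { intros k. apply (choice (fun n x => Gs n x /\ x zero = q k)). intros n.
    apply (ghost_param (Sn n) r). apply HGs. }
  destruct (approx_growth Sn Sinf r Gs ws winf H) as [W [HW HWG]].
  destruct (config_diagonal a) as [phi [Hphi Hlim]].
  { intros k i. exists (Rabs (q k) + 1 + W * IZR (lnorm i)). intros n.
    destruct (Ha k n) as [HG Hz]. pose proof (linear_growth_abs W (a k n) i (HWG n _ HG)) as P.
    rewrite Hz in P. exact P. }
  pose proof (ghost_approximation_extraction _ _ _ _ _ _ phi H Hphi) as Hsub.
  assert (Hdense : forall xi eps, 0 < eps ->
    exists x, limit_set (fun m => Gs (phi m)) x /\ Rabs (x zero - xi) < eps).
  { intros xi eps Heps. destruct (Hq xi eps Heps) as [k Hk]. destruct (Hlim k) as [x Hx].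
    exists x. split; [apply (limit_set_of_seq _ (fun m => a k (phi m))); auto; intros n; apply Ha|].
    replace (x zero) with (q k); [assumption|].
    apply (UL_sequence (fun m => a k (phi m) zero)); [|apply Hx].
    apply (Un_cv_ext (fun _ => q k)); [|apply Un_cv_const]. intros n. symmetry; apply Ha. }
  exists (limit_set (fun m => Gs (phi m))), phi. split; [|split; [|split; [|split]]].
  - exact (limit_set_ghost_circle _ _ _ _ _ _ Hsub Hdense).
  - exact (limit_set_rot _ _ _ _ _ _ Hsub).
  - exact Hphi.
  - exact (limit_set_ghost_conv _ _ _ _ _ _ Hsub).
  - intros _ Hmin. apply (limit_set_global_min _ _ _ _ _ _ Hsub Hdense). intros n; apply Hmin.
Qed.
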